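(* Let $\Omega\subset\mathbb{R}^n$ be a proper, open, nonempty subset, let $1<p\le q<\infty$, $p'=p/(p-1)$, and $0<\beta<1$. Let $(u,v)$ be a pair of weights such that $\sigma=v^{1-p'}\in D_\beta$. Then there is a constant $C$ such that $$\left(\int_\Omega (M_\beta f)^q\,u\,dx\right)^{1/q}\le C\left(\int_\Omega|f|^p\,v\,dx\right)^{1/p}\quad\text{for every } f\in L^p(v)$$ if and only if there is a constant $C$ such that $$\left(\int_Q \big(M_\beta(\sigma\chi_Q)\big)^q\,u\,dx\right)^{1/q}\le C\left(\int_Q\sigma\,dx\right)^{1/p}<\infty\quad\text{for every cube } Q\in\mathcal{F}_\beta.$$
   Context: Cubes have sides parallel to the axes; $Q(x,l)$ is the cube with center $x$ and half side length $l>0$. $\mathrm{d}$ is the $d_\infty$ metric on $\mathbb{R}^n$, and $\mathrm{d}(x,\Omega^c)$ the corresponding distance to $\Omega^c=\mathbb{R}^n\setminus\Omega$. $\mathcal{F}_\beta=\{Q(x,l): x\in\Omega,\ l<\beta\,\mathrm{d}(x,\Omega^c)\}$. A weight is a nonnegative locally integrable function on $\Omega$; for a weight $w$ write $w(Q)=\int_Q w\,dx$, and $L^p(w)$ is the space of measurable $f$ on $\Omega$ with $\int_\Omega|f|^p w\,dx<\infty$. A weight $w$ belongs to $D_\beta$ if there is a constant $C_\beta$ such that $w(2Q)\le C_\beta\,w(Q)<\infty$ for every cube $Q\in\mathcal{F}_\beta$ such that $2Q\in\mathcal{F}_\beta$, where $2Q$ is the cube concentric with $Q$ with twice its side length. For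 $x\in\Omega$ and a locally integrable $f$ on $\Omega$, $M_\beta f(x)=\sup_{x\in Q\in\mathcal{F}_\beta}\frac1{|Q|}\int_Q|f(y)|\,dy$. *)

(* Defs.v *)
From HB Require Import structures.
From mathcomp Require Import all_boot all_order all_algebra.
From mathcomp Require Import all_classical all_reals all_analysis.
From mathcomp Require Import measurable_realfun.

Set Implicit Arguments.
Unset Strict Implicit.
Unset Printing Implicit Defensive.

Import Order.TTheory GRing.Theory Num.Theory.
Import numFieldNormedType.Exports.

Local Open Scope classical_set_scope.
Local Open Scope ring_scope.

(** R^(n+1) is ['rV[R]_n.+1], whose library norm is the sup norm.  Lebesgue
    measure on it is obtained by Caratheodory's construction from the outer
    measure below, so that "measurable" means Lebesgue measurable. *)

Section lebesgue_rV.
Context {R : realType} {n : nat}.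
Implicit Types (a b : 'rV[R]_n.+1) (A : set 'rV[R]_n.+1).

Definition box a b : set 'rV[R]_n.+1 :=
  [set x | forall i, a ord0 i < x ord0 i <= b ord0 i].

Definition box_volume a b : R :=
  \prod_(i < n.+1) Num.max 0 (b ord0 i - a ord0 i).

Local Open Scope ereal_scope.

Definition box_cover A : set (nat -> 'rV[R]_n.+1 * 'rV[R]_n.+1) :=
  [set F | A `<=` \bigcup_k box (F k).1 (F k).2].

Definition lebesgue_outer A : \bar R :=
  ereal_inf [set \sum_(k <oo) (box_volume (F k).1 (F k).2)%:E
            | F in box_cover A].

Lemma box_volume_ge0 a b : (0 <= box_volume a b)%R.
Proof. by apply: prodr_ge0 => i _; rewrite le_max lexx. Qed.

Lemma lebesgue_outer_ge0 A : 0 <= lebesgue_outer A.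
Proof.
apply: le_ereal_inf_tmp => _ [F _ <-].
by apply: nneseries_ge0 => k _ _; rewrite lee_fin box_volume_ge0.
Qed.

Lemma le_lebesgue_outer : {homo lebesgue_outer : A B / A `<=` B >-> A <= B}.
Proof.
move=> A B AB; apply/ereal_inf_le_tmp => _ [F BF <-].
by exists F => //; exact: subset_trans AB BF.
Qed.

Lemma lebesgue_outer0 : lebesgue_outer set0 = 0.
Proof.
apply/eqP; rewrite eq_le lebesgue_outer_ge0 andbT.
apply: ereal_inf_lbound; exists (fun=> (0%R, 0%R)); first by move=> x [].
apply: eseries0 => k _ _ /=.
by rewrite /box_volume big_ord_recl subrr maxxx mul0r.
Qed.

Lemma lebesgue_outer_sigma_subadditive : sigma_subadditive lebesgue_outer.
Proof.
move=> A; have [[i ioo]|] := pselect (exists i, lebesgue_outer (A i) = +oo).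
  rewrite (eseries_pinfty _ _ ioo) ?leey// => k _.
  by rewrite -ltNye (lt_le_trans _ (lebesgue_outer_ge0 _)).
rewrite -forallNE => Aoo.
suff add2e (e : {posnum R}) : lebesgue_outer (\bigcup_k A k) <=
    \sum_(i <oo) lebesgue_outer (A i) + e%:num%:E.
  by apply/lee_addgt0Pr => _/posnumP[].
rewrite (le_trans _ (epsilon_trick _ _ _))//; last first.
  by move=> k; exact: lebesgue_outer_ge0.
pose vol (c : 'rV[R]_n.+1 * 'rV[R]_n.+1) := (box_volume c.1 c.2)%:E.
have vol_ge0 c : 0 <= vol c by rewrite lee_fin box_volume_ge0.
pose P k F := box_cover (A k) F /\ \sum_(j <oo) vol (F j) <=
  lebesgue_outer (A k) + (e%:num / (2 ^ k.+1)%:R)%:E.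
have [G PG] : {G : nat -> nat -> 'rV[R]_n.+1 * 'rV[R]_n.+1 &
    forall k, P k (G k)}.
  apply: (@choice _ _ P) => k; rewrite /P /lebesgue_outer.
  set S := (X in ereal_inf X); move infS : (ereal_inf S) => iS.
  case: iS infS => [r Sr|Soo|Soo].
  - have en1 : (0 < e%:num / (2 ^ k.+1)%:R)%R by [].
    have /(lb_ereal_inf_adherent en1) : ereal_inf S \is a fin_num by rewrite Sr.
    move=> [x [F AF muFx] xS].
    by exists F; split => //; rewrite muFx -Sr; exact/ltW.
  - by have := Aoo k; rewrite /lebesgue_outer Soo.
  - suff : lbound S 0 by move/le_ereal_inf_tmp; rewrite Soo.
    by move=> /= _ [F AF <-]; apply: nneseries_ge0 => k0 _ _; exact: vol_ge0.
apply: (@le_trans _ _ (\esum_(i in setT) (vol \o uncurry G) i)).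
  apply: ereal_inf_lbound => /=.
  have /card_esym/ppcard_eqP[f] := card_nat2.
  exists (uncurry G \o f).
    move=> t [i _ Ait]; have [j _ Gijt] := (PG i).1 t Ait.
    by exists (f^-1%FUN (i, j)) => //=; rewrite invK ?inE.
  rewrite -(esum_pred_image (vol \o uncurry G) _ xpredT) ?[fun=> _]set_true//;
    last by move=> ? _; exact: vol_ge0.
  by rewrite image_eq.
rewrite (_ : esum _ _ = \sum_(i <oo) \sum_(j <oo ) vol (G i j)); last first.
  rewrite (@nneseries_esumT _ (fun i => \sum_(j <oo) vol (G i j))); last first.
    by move=> i; exact: nneseries_ge0.
  transitivity (\esum_(i in [set: nat]) \esum_(j in [set: nat]) vol (G i j)).
    rewrite (@esum_esum _ _ _ setT (fun=> setT) (fun i j => vol (G i j)))//.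
    rewrite (_ : _ `*`` _ = setT); last by apply/seteqP; split.
    by apply: eq_esum => -[].
  by apply: eq_esum => i _; rewrite nneseries_esumT.
apply: lee_nneseries => [k _ _|k _]; first exact: nneseries_ge0.
exact: (PG k).2.
Qed.

HB.instance Definition _ := isOuterMeasure.Build R _ lebesgue_outer
  lebesgue_outer0 lebesgue_outer_ge0 le_lebesgue_outer
  lebesgue_outer_sigma_subadditive.

End lebesgue_rV.

Definition Rn (R : realType) (n : nat) : Type := 'rV[R]_n.+1.

HB.instance Definition _ (R : realType) (n : nat) :=
  NormedModule.copy (Rn R n) 'rV[R]_n.+1.
HB.instance Definition _ (R : realType) (n : nat) :=
  Measurable.copy (Rn R n) (caratheodory_type (@lebesgue_outer R n)).

Definition lebesgue_measure_Rn {R : realType} {n : nat} : set (Rn R n) -> \bar R :=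
  @lebesgue_outer R n.

HB.instance Definition _ (R : realType) (n : nat) :=
  Measure.copy (@lebesgue_measure_Rn R n)
    ((@lebesgue_outer R n : {outer_measure set 'rV[R]_n.+1 -> \bar R})
      : set (caratheodory_type (@lebesgue_outer R n)) -> \bar R).

Section local_maximal.
Context {R : realType} {n : nat}.
Implicit Types (Omega Q : set (Rn R n)) (x y : Rn R n) (l beta : R).
Implicit Types (w f : Rn R n -> \bar R).

Local Notation mu := (@lebesgue_measure_Rn R n).

Definition dist_set x (A : set (Rn R n)) : R :=
  inf [set `|x - y| | y in A].

Definition cube x l : set (Rn R n) := [set y | `|x - y| <= l].

(** A cube is represented by its center and half side length; concentric
    dilation acts on the second component. *)
Definition cubes Omega beta : set (Rn R n * R) :=
  [set c | [/\ Omega c.1, 0 < c.2 & c.2 < beta * dist_set c.1 (~` Omega)]].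

Local Open Scope ereal_scope.

(** Functions on [Omega] are total functions of which only the restriction to
    [Omega] matters.  Weights may take the value [+oo], since a negative power
    of a weight does so where the weight vanishes. *)
Definition weight Omega w :=
  [/\ measurable_fun Omega w, (forall x, Omega x -> 0 <= w x) &
    forall K : set (Rn R n), K `<=` Omega -> compact K ->
      \int[mu]_(x in K) w x < +oo].

Definition wmeas w Q : \bar R := \int[mu]_(x in Q) w x.

Definition doubling Omega beta w :=
  weight Omega w /\
  exists C : R, forall x l,
    cubes Omega beta (x, l) -> cubes Omega beta (x, 2 * l)%R ->
    wmeas w (cube x (2 * l)) <= C%:E * wmeas w (cube x l) < +oo.

Definition Lp_weighted Omega (p : R) v f :=
  measurable_fun Omega f /\ \int[mu]_(x in Omega) (`|f x| `^ p * v x) < +oo.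

Definition average f Q : \bar R := (mu Q)^-1 * \int[mu]_(y in Q) `|f y|.

Definition maximal Omega beta f x : \bar R :=
  ereal_sup [set average f (cube c.1 c.2)
            | c in cubes Omega beta `&` [set c | cube c.1 c.2 x]].

(** [x `^ r] is [0] at [x = 0] and [+oo] at [x = +oo] also when [r < 0]; for
    negative exponents we need the values [+oo] and [0] instead. *)
Definition wpow (x : \bar R) (r : R) : \bar R :=
  if (r < 0)%R then (x `^ (- r))^-1 else x `^ r.

End local_maximal.

(* Main.v *)
(** For the hard direction write [|f| = g sigma] and discretize: [M_beta f] is
    the supremum of the averages over a countable family of cubes, and for
    finitely many cubes Q_i the function max_i (average over Q_i) 1_(Q_i) takes
    its i-th value on a set E_i, the E_i being disjoint with E_i inside Q_i.
    The integral to estimate is then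
      sum_i u(E_i) (sigma(Q_i)/|Q_i|)^q A_i^q,   A_i = (int_(Q_i) g sigma)/sigma(Q_i).
    Group the cubes by the dyadic level t of A_i and select, by Vitali, disjoint
    cubes Q_s in each group.  The terms of all smaller cubes Q_i that meet Q_s
    sum up to at most C sigma(Q_s)^(q/p).  This is where the testing condition
    and D_beta enter: 3 Q_s is not admissible when beta is close to 1, but it is
    covered by boundedly many small cubes, and doubling along chains of
    admissible cubes shows that those that matter have sigma-measure comparable
    to sigma(Q_s).  As q/p >= 1, the powers come out of the sum, and
    t sigma(Q_s) <= 2 int_(Q_s, 2g > t) g sigma; summing t^(p-1) over the dyadic
    levels t < 2g leaves a multiple of int g^p sigma = int |f|^p v. *)

(* The choice of [sigma] rests on sigma^(p-1) v = 1 almost everywhere: it gives g^p sigma = |f|^p v,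
   and also sigma^p v = sigma, so that f = sigma chi_Q yields the easy direction. The quotient g is
   never formed, because [sigma] may vanish or be [+oo] on a null set; 2g > t is written (t/2) sigma
   < |f|. The testing condition on an admissible cube Q controls any finite family of cubes Q_i
   inside Q, because sigma(Q_i)/|Q_i| <= M_beta(sigma chi_Q) on E_i. The obstacle is that it says
   nothing about cubes outside the family. The only cubes near Q(c, l) that are sure to be
   admissible are those centered in Q(c, l) with half side at most (1 - beta) l. This ratio
   determines the mesh of the tiling, the threshold between small and large cubes, and the length of
   the doubling chains. Finiteness keeps all sums in R and lets the selection pick a largest cube;
   monotone convergence then restores the supremum. The measure of the unit cube is never computed,
   only scaled. *)
Require Import Defs.
From mathcomp Require Import all_boot all_order all_algebra.
From mathcomp Require Import all_classical all_reals all_analysis.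
From mathcomp Require Import measurable_realfun.
From mathcomp Require Import lra ring.
Import Order.TTheory GRing.Theory Num.Theory.
Import numFieldNormedType.Exports.
Local Open Scope classical_set_scope.
Local Open Scope ring_scope.

(** * Lebesgue measure of cubes *)

Section lebesgue.
Context {R : realType} {n : nat}.
Implicit Types (x y z c : Rn R n) (l t : R) (a b : 'rV[R]_n.+1).
Local Notation mu := (@lebesgue_measure_Rn R n).
Local Notation N := n.+1.

Definition update_coord a (i : 'I_N) t : 'rV[R]_N :=
  \row_j (if j == i then t else a ord0 j).

(** The hyperplane x_i = t cuts a box in two. Truncating the sides at 0 in [box_volume] makes the
    identity hold also when the hyperplane misses the box. *)
Lemma box_volume_split a b i t :
  box_volume (R:=R) a b = box_volume a (update_coord b i (Num.min (b ord0 i) t)) +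
    box_volume (update_coord a i (Num.max (a ord0 i) t)) b.
Proof.
rewrite /box_volume (bigD1 i)//= [X in _ = X + _](bigD1 i)//=.
rewrite [X in _ = _ + X](bigD1 i)//= !mxE eqxx.
under [X in _ = _ * X + _]eq_bigr => j /negPf ji do rewrite mxE ji.
under [X in _ = _ + _ * X]eq_bigr => j /negPf ji do rewrite mxE ji.
rewrite -mulrDl; congr (_ * _).
set A := a _ _; set B := b _ _.
have [At|tA] := leP A t; have [Bt|tB] := leP B t;
  rewrite ?(min_idPl Bt) ?(min_idPr (ltW tB)) ?(max_idPr At) ?(max_idPl (ltW tA));
  repeat (case: leP => ?); lra.
Qed.

(** Caratheodory's criterion: cutting each box of a cover of [X] gives covers of the two parts of
    [X] with the same total volume. The boxes are open on the left and closed on the right, which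
    matches the cut into x_i <= t and x_i > t. *)
Lemma measurable_halfspace_le i t :
  measurable ([set x : Rn R n | (x ord0 i <= t)%R] : set (Rn R n)).
Proof.
apply: le_caratheodory_measurable => X /=.
apply: le_ereal_inf_tmp => _ [F XF <-].
set H := [set x : Rn R n | _].
pose F1 k := ((F k).1, update_coord (F k).2 i (Num.min ((F k).2 ord0 i) t)).
pose F2 k := (update_coord (F k).1 i (Num.max ((F k).1 ord0 i) t), (F k).2).
have -> : (\sum_(k <oo) (box_volume (F k).1 (F k).2)%:E =
   \sum_(k <oo) (box_volume (F1 k).1 (F1 k).2)%:E +
   \sum_(k <oo) (box_volume (F2 k).1 (F2 k).2)%:E)%E.
  rewrite -nneseriesD; try by move=> *; rewrite lee_fin box_volume_ge0.
  by apply: eq_eseriesr => k _; rewrite -EFinD -box_volume_split.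
apply: leeD; apply: ereal_inf_lbound; eexists; try by reflexivity.
- move=> x [Xx Hx]; have [k _ xk] := XF _ Xx; exists k => //= j.
  rewrite mxE; case: eqP => [->|_]; last exact: xk.
  by rewrite le_min; have /andP[-> ->] := xk i; rewrite Hx.
- move=> x [Xx /negP]; rewrite -ltNge => Hx; have [k _ xk] := XF _ Xx; exists k => //= j.
  rewrite mxE; case: eqP => [->|_]; last exact: xk.
  by rewrite gt_max; have /andP[-> ->] := xk i; rewrite Hx.
Qed.

Lemma measurable_halfspace_ge i t :
  measurable ([set x : Rn R n | (t <= x ord0 i)%R] : set (Rn R n)).
Proof.
have -> : [set x : Rn R n | (t <= x ord0 i)%R] =
    \bigcap_k ~` [set x : Rn R n | x ord0 i <= t - k.+1%:R^-1].
  apply/seteqP; split => x /=.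
    move=> tx k _ /=; apply/negP; rewrite -ltNge.
    by rewrite (lt_le_trans _ tx)// ltrBlDr ltrDl.
  move=> H; rewrite leNgt; apply/negP => xt.
  have d0 : 0 < t - x ord0 i by rewrite subr_gt0.
  have [k _ /(_ k (leqnn k)) /= kP] := near_infty_natSinv_lt (PosNum d0).
  by apply: (H k I) => /=; rewrite lerBrDl -lerBrDr ltW.
apply: bigcapT_measurable => k; apply: measurableC.
exact: measurable_halfspace_le.
Qed.

Lemma cubeP c l x : 0 <= l ->
  cube c l x <-> forall i, c ord0 i - l <= x ord0 i <= c ord0 i + l.
Proof.
move=> l0; rewrite /cube /= {1}/Num.norm /= mx_normrE; split.
  move=> /bigmax_leP[_ H] i; rewrite -ler_distlC.
  by have := H (ord0, i) isT; rewrite !mxE.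
move=> H; apply/bigmax_leP; split => // -[i j] _ /=.
by rewrite !mxE ord1 ler_distlC H.
Qed.

Lemma measurable_cube c l : measurable (cube c l).
Proof.
have [l0|l0] := ltP l 0.
  rewrite (_ : cube c l = set0)//; apply/seteqP; split => // x.
  by rewrite /cube /= => xl; have := le_lt_trans (le_trans (normr_ge0 _) xl) l0; rewrite ltxx.
have -> : cube c l = \bigcap_(i in [set` 'I_N])
    ([set x : Rn R n | (c ord0 i - l <= x ord0 i)%R] `&`
     [set x : Rn R n | (x ord0 i <= c ord0 i + l)%R]).
  apply/seteqP; split => x.
    by move=> /(cubeP _ _ _ l0) H i _ /=; have /andP[] := H i.
  move=> H; apply/(cubeP _ _ _ l0) => i.
  by have [/= -> ->] := H i isT.
apply: fin_bigcap_measurable => // i _; apply: measurableI.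
- exact: measurable_halfspace_ge.
- exact: measurable_halfspace_le.
Qed.

Lemma closed_cube c l : 0 < l -> closed (cube c l : set (Rn R n)).
Proof.
move=> l0; have -> : cube c l = closed_ball (c : Rn R n) l by rewrite closed_ballE.
exact: closed_ball_closed.
Qed.

Lemma compact_cube c l : 0 < l -> compact (cube c l : set (Rn R n)).
Proof.
move=> l0; apply: bounded_closed_compact; last exact: closed_cube.
exists (`|c| + l); split; first exact: num_real.
move=> M cM x; rewrite /cube /= => xl.
rewrite (le_trans _ (ltW cM))// -[x](subKr c) (le_trans (ler_normB _ _))//.
by rewrite lerD2l.
Qed.

Lemma lebesgue_measure_affine_le c l (A : set (Rn R n)) : 0 < l ->
  (mu ((fun x : Rn R n => (c + l *: x)%R) @` A) <= (l ^+ N)%:E * mu A)%E.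
Proof.
move=> l0; rewrite /lebesgue_measure_Rn {2}/lebesgue_outer.
rewrite -ereal_inf_pZl ?exprn_gt0//.
apply: le_ereal_inf_tmp => _ [_ [F AF <-] <-].
apply: ereal_inf_lbound.
exists (fun k => (c + l *: (F k).1, c + l *: (F k).2)).
  move=> _ [x Ax <-]; have [k _ xk] := AF _ Ax; exists k => //= i.
  by rewrite !mxE ltrD2l lerD2l ltr_pM2l// ler_pM2l.
rewrite -nneseriesZl; last by move=> k _; rewrite lee_fin box_volume_ge0.
apply: eq_eseriesr => k _; rewrite -EFinM; congr EFin.
have -> : l ^+ N = \prod_(i < N) l by rewrite prodr_const card_ord.
rewrite /box_volume -big_split/=.
apply: eq_bigr => i _; rewrite !mxE opprD addrACA subrr add0r -mulrBr.
by rewrite maxr_pMr ?mulr0// ltW.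
Qed.

(** Both inequalities come from [lebesgue_measure_affine_le], applied to x -> c + l x and to its
    inverse. *)
Lemma lebesgue_measure_cube c l : 0 < l -> mu (cube c l) = ((l ^+ N)%:E * mu (cube 0%R 1%R))%E.
Proof.
move=> l0.
have E1 : cube c l = (fun x : Rn R n => c + l *: x) @` cube 0 1.
  apply/seteqP; split => [x|_ [x + <-]]; rewrite /cube /=.
    move=> xl; exists (l^-1 *: (x - c)).
      rewrite sub0r normrN normrZ normfV (gtr0_norm l0) distrC.
      by rewrite mulrC ler_pdivrMr// mul1r.
    by rewrite scalerA divff ?gt_eqF// scale1r addrC subrK.
  rewrite sub0r normrN opprD addrA subrr add0r normrN normrZ gtr0_norm//.
  by move=> x1; rewrite -[leRHS]mulr1 ler_pM2l.
have E2 : cube 0 1 = (fun x : Rn R n => - (l^-1 *: c) + l^-1 *: x) @` cube c l.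
  rewrite E1 image_comp -[LHS]image_id; apply: eq_imagel => x _ /=.
  by rewrite scalerDr scalerA mulVf ?gt_eqF// scale1r addrA addNr add0r.
apply/eqP; rewrite eq_le {1}E1 lebesgue_measure_affine_le//=.
rewrite muleC -lee_pdivlMr ?exprn_gt0// muleC -exprVn {1}E2.
by rewrite lebesgue_measure_affine_le// invr_gt0.
Qed.

Lemma lebesgue_measure_cube_lty c l : (mu (cube c l) < +oo)%E.
Proof.
(* A box lacks its left faces, so the covering box has to be strictly larger than the cube; [|l|]
   takes care of negative [l]. *)
apply: (@le_lt_trans _ _ (box_volume (R:=R) (c - const_mx (`|l| + 1)) (c + const_mx (`|l| + 1)))%:E);
  last exact: ltry.
pose F k : 'rV[R]_N * 'rV[R]_N := if k is 0%N then (c - const_mx (`|l| + 1), c + const_mx (`|l| + 1)) else (0, 0).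
apply: (@le_trans _ _ (\sum_(k <oo) (box_volume (F k).1 (F k).2)%:E)%E).
  apply: ereal_inf_lbound; exists F => // x xl; exists 0%N => //= i.
  have /cubeP : cube c `|l| x by rewrite /cube /= (le_trans xl)// ler_norm.
  move=> /(_ (normr_ge0 _) i) /andP[H1 H2].
  rewrite !mxE; apply/andP; split; lra.
rewrite (nneseries_split 0 1)//; last by move=> k _; rewrite lee_fin box_volume_ge0.
rewrite big_nat1 /= eseries0 ?adde0//.
by move=> [|k] // _ _; rewrite /= /box_volume big_ord_recl subrr maxxx mul0r.
Qed.

(** By scaling, all cubes are null and countably many of them cover the space. This serves the
    degenerate case of the theorem. *)
Lemma lebesgue_measure_Rn_eq0 : mu (cube 0%R 1%R) = 0%E -> forall A, measurable A -> mu A = 0%E.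
Proof.
move=> V0 A mA; apply/eqP; rewrite eq_le measure_ge0 andbT.
have Acov : A `<=` \bigcup_k cube 0 k.+1%:R.
  by move=> x _; exists (Num.trunc `|x|) => //=;
    rewrite /cube /= sub0r normrN ltW// truncnS_gt.
apply: (le_trans (measure_sigma_subadditive mu _ mA Acov)).
  by move=> k; exact: measurable_cube.
rewrite eseries0// => k _ _.
by transitivity ((k.+1%:R ^+ N)%:E * mu (cube 0%R 1%R))%E;
  [exact: lebesgue_measure_cube|rewrite V0 mule0].
Qed.

End lebesgue.

(** * The cubes of [cubes Omega beta] *)

Section geometry.
Context {R : realType} {n : nat}.
Implicit Types (x y z c : Rn R n) (l r : R).
Local Notation N := n.+1.

Lemma dist_set_ge0 x (A : set (Rn R n)) : 0 <= dist_set x A.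
Proof.
rewrite /dist_set; have [[y Ay]|A0] := pselect (A !=set0).
  by apply: lb_le_inf; [exists `|x - y|, y|move=> _ [z _ <-]].
suff -> : [set `|x - y| | y in A] = set0 by rewrite inf0.
by apply/seteqP; split => // t [y Ay _]; case: A0; exists y.
Qed.

Lemma dist_set_le x y (A : set (Rn R n)) : A y -> dist_set x A <= `|x - y|.
Proof. by move=> Ay; apply: ge_inf; [exists 0 => _ [z _ <-]|exists y]. Qed.

Lemma dist_set_lip x y (A : set (Rn R n)) : A !=set0 ->
  dist_set x A <= `|x - y| + dist_set y A.
Proof.
move=> [a Aa]; rewrite -lerBlDl; apply: lb_le_inf; first by exists `|y - a|, a.
move=> _ [z Az <-]; rewrite lerBlDl (le_trans (dist_set_le x z A Az))//.
by rewrite -{1}(subrK y x) -addrA ler_normD.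
Qed.

Lemma dist_set_gt0 x (A : set (Rn R n)) : open A -> ~` A !=set0 -> A x ->
  0 < dist_set x (~` A).
Proof.
move=> oA A0 Ax.
have /nbhs_ballP[e /= e0 eA] : nbhs x A by exact: open_nbhs_nbhs.
apply: (lt_le_trans e0); apply: lb_le_inf.
  by have [y Ay] := A0; exists `|x - y|, y.
move=> _ [y Ay <-]; rewrite leNgt; apply/negP => xy; apply: Ay; apply: eA.
by rewrite -ball_normE.
Qed.

Lemma cube_center c l : 0 <= l -> cube c l c.
Proof. by rewrite /cube /= subrr normr0. Qed.

Lemma cube_subset c l z r : `|c - z| + r <= l -> cube z r `<=` cube c l.
Proof.
move=> H y; rewrite /cube /= => zy; apply: le_trans H.
by rewrite -(subrK z c) -addrA (le_trans (ler_normD _ _))// subrK lerD2l.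
Qed.

Lemma cube_dist c l x y : cube c l x -> cube c l y -> `|x - y| <= 2 * l.
Proof.
rewrite /cube /= => cx cy; rewrite -(subrK c x) -addrA (le_trans (ler_normD _ _))//.
by rewrite mulr2n mulrDl mul1r lerD// distrC.
Qed.

Lemma cube_segment c l x y (t : R) : 0 <= t <= 1 -> cube c l x -> cube c l y ->
  cube c l (x + t *: (y - x)).
Proof.
move=> /andP[t0 t1]; rewrite /cube /= => cx cy.
have -> : c - (x + t *: (y - x)) = (1 - t) *: (c - x) + t *: (c - y).
  by rewrite scalerBl !scalerBr scale1r opprD opprB; apply/matrixP => i j; rewrite !mxE; ring.
rewrite (le_trans (ler_normD _ _))// !normrZ (ger0_norm t0).
rewrite [`|1 - t|]ger0_norm ?subr_ge0//.
rewrite (@le_trans _ _ ((1 - t) * l + t * l))//; last by rewrite -mulrDl subrK mul1r.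
by rewrite lerD// ler_wpM2l// subr_ge0.
Qed.

(** Grid of mesh l/m in Q(c, l). The tiles around these points get half side l/m, twice what a
    partition needs, so that rounding each coordinate down finds a tile. The index 2m is there for
    the right face. *)
Definition tile c l (m : nat) (k : {ffun 'I_N -> 'I_(2 * m).+1}) : Rn R n :=
  \row_i (c ord0 i - l + (k i)%:R * (l / m%:R)).

Lemma tile_cover c l m x : 0 < l -> (0 < m)%N -> cube c l x ->
  exists k, cube (tile c l m k) (l / m%:R) x.
Proof.
move=> l0 m0 /(cubeP _ _ _ (ltW l0)) cx.
have m0R : 0 < m%:R :> R by rewrite ltr0n.
have lm0 : 0 < l / m%:R by rewrite divr_gt0.
pose t i := (x ord0 i - c ord0 i + l) / (l / m%:R).
have t0 i : 0 <= t i.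
  by rewrite divr_ge0 ?(ltW lm0)//; have /andP[] := cx i; lra.
have tm i : (Num.trunc (t i) < (2 * m).+1)%N.
  rewrite ltnS truncn_le_nat -addn1 natrD ltr_pwDr// ler_pdivrMr//.
  have -> : (2 * m)%:R * (l / m%:R) = 2 * l.
    by rewrite natrM; field; rewrite gt_eqF.
  by have /andP[] := cx i; lra.
exists [ffun i => Ordinal (tm i)]; apply/cubeP; first exact: ltW.
move=> i; rewrite !mxE ffunE /=.
have /andP[] := truncn_itv (t0 i).
set k := Num.trunc _; rewrite ler_pdivlMr// ltr_pdivrMr// [k.+1%:R]mulrSr mulrDl mul1r.
move=> H1 H2; apply/andP; split; lra.
Qed.

Lemma tile_center c l m k : 0 < l -> (0 < m)%N -> cube c l (tile c l m k).
Proof.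
move=> l0 m0; apply/(cubeP _ _ _ (ltW l0)) => i; rewrite mxE.
have m0R : 0 < m%:R :> R by rewrite ltr0n.
have lm0 : 0 < l / m%:R by rewrite divr_gt0.
have : 0 <= (k i)%:R * (l / m%:R) <= 2 * l.
  rewrite mulr_ge0//=; last exact: ltW.
  by rewrite mulrA ler_pdivrMr// mulrAC ler_pM2r// -natrM ler_nat -ltnS.
by move=> /andP[? ?]; apply/andP; split; lra.
Qed.

Context (Omega : set (Rn R n)) (beta : R).
Context (Omega_open : open Omega) (Omega_proper : ~` Omega !=set0).
Context (beta01 : 0 < beta < 1).
Local Notation F := (cubes Omega beta).
Local Notation d x := (dist_set x (~` Omega)).

Lemma cubes_gt0 c l : F (c, l) -> 0 < l.
Proof. by case. Qed.

Lemma dist_mem x y : `|x - y| < d x -> Omega y.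
Proof.
by move=> H; apply: contrapT => Oy; have := dist_set_le x y (~` Omega) Oy; rewrite leNgt H.
Qed.

Lemma cubes_subset c l : F (c, l) -> cube c l `<=` Omega.
Proof.
move=> [_ _ /= ld] y cy; apply: dist_mem; apply: (le_lt_trans cy).
have [_ b1] := andP beta01.
by rewrite (lt_le_trans ld)// ler_piMl ?dist_set_ge0// ltW.
Qed.

(** The distance d to the complement is 1-Lipschitz, so beta d(z) >= beta d(c) - beta l > (1 - beta)
    l for z in Q(c, l). *)
Lemma cubes_small c l z r : F (c, l) -> cube c l z -> 0 < r ->
  r <= (1 - beta) * l -> F (z, r).
Proof.
move=> Fcl cz r0 rl; split => //=; first exact: cubes_subset Fcl _ cz.
have [_ /= l0 ld] := Fcl; have [b0 b1] := andP beta01.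
have := dist_set_lip c z _ Omega_proper => H.
apply: (le_lt_trans rl).
rewrite (@lt_le_trans _ _ (beta * (d c - l)))//.
  by rewrite mulrBl mul1r mulrBr ltrD2r.
by rewrite ler_pM2l// lerBlDl (le_trans H)// lerD2r.
Qed.

Lemma cubes_shrink c l r : F (c, l) -> 0 < r -> r <= l -> F (c, r).
Proof. by move=> [Oc _ /= ld] r0 rl; split => //=; exact: le_lt_trans ld. Qed.

Lemma cubes_nonempty x : Omega x -> exists2 l, F (x, l) & 0 < l.
Proof.
move=> Ox; have d0 := dist_set_gt0 _ _ Omega_open Omega_proper Ox.
have [b0 _] := andP beta01.
have bd : 0 < beta * d x by rewrite mulr_gt0.
by exists (beta * d x / 2); [split => //=|]; lra.
Qed.

(** Rational centers and half sides suffice, because admissibility is a strict inequality and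
    survives a slight move and enlargement of the cube. Codes of inadmissible cubes are sent to a
    fixed admissible one. *)
Lemma countable_cubes : Omega !=set0 -> exists D : nat -> Rn R n * R,
  (forall k, F (D k)) /\
  forall c l rho, F (c, l) -> 1 < rho ->
    exists k, cube c l `<=` cube (D k).1 (D k).2 /\ (D k).2 <= rho * l.
Proof.
move=> [w Ow]; have [l0 Fw _] := cubes_nonempty _ Ow.
pose G (k : nat) : Rn R n * R :=
  if (unpickle k : option ('rV[rat]_N * rat)) is Some q
  then (map_mx ratr q.1, ratr q.2) else (w, l0).
exists (fun k => if pselect (F (G k)) then G k else (w, l0)); split.
  by move=> k; case: pselect.
move=> c l rho Fcl rho1; have [Oc /= lpos ld] := Fcl.
(* The center moves by at most [th], the half side grows by between [th] and [2 * th], and beta d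
   drops by at most [th]; a slack of [4 * th] absorbs all three. *)
pose th := Num.min ((rho - 1) * l) (beta * d c - l) / 4.
have th0 : 0 < th.
  by rewrite /th divr_gt0// lt_min subr_gt0 ld mulr_gt0// subr_gt0.
have th1 : 4 * th <= (rho - 1) * l.
  by rewrite /th mulrCA divff// mulr1 ge_min lexx.
have th2 : 4 * th <= beta * d c - l.
  by rewrite /th mulrCA divff// mulr1 ge_min lexx orbT.
have H i : exists q : rat, ratr q \in `](c ord0 i), (c ord0 i + th)[%R.
  by apply: rat_in_itvoo; rewrite ltrDl.
pose c0 := \row_i projT1 (cid (H i)).
have [l' ] : exists q : rat, ratr q \in `](l + th), (l + 2 * th)[%R.
  by apply: rat_in_itvoo; lra.
rewrite in_itv/= => /andP[l'1 l'2].
pose c' : Rn R n := map_mx ratr c0.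
have cc' : `|c - c'| <= th.
  suff : cube c th c' by [].
  apply/(cubeP _ _ _ (ltW th0)) => i; rewrite /c' /c0 !mxE.
  case: cid => q /=; rewrite in_itv/= => /andP[? ?].
  by apply/andP; split; lra.
have [b0 b1] := andP beta01.
have dc0 := dist_set_ge0 c (~` Omega).
have bd : beta * d c <= d c by rewrite ler_piMl// ltW.
have dc' := dist_set_lip c c' _ Omega_proper.
have Fc' : F (c', ratr l').
  split => /=; first by apply: (dist_mem c); lra.
    lra.
  have : beta * d c <= beta * (th + d c').
    by rewrite ler_pM2l// (le_trans dc')// lerD2r.
  have : beta * th <= th by rewrite ler_piMl// ltW.
  rewrite mulrDr; lra.
exists (pickle (c0, l')).
have GE : G (pickle (c0, l')) = (c', ratr l') by rewrite /G pickleK.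
rewrite GE; case: pselect => //= _; split; last lra.
by apply: cube_subset; rewrite distrC; lra.
Qed.

End geometry.

(** * Weighted measures *)

Section weights.
Context {R : realType} {n : nat}.
Local Notation mu := (@lebesgue_measure_Rn R n).
Local Notation N := n.+1.
Context (Omega : set (Rn R n)) (beta : R).
Context (Omega_measurable : measurable Omega) (beta01 : 0 < beta < 1).
Local Notation F := (cubes Omega beta).

(** Measurable sets of this kind have finite measure for every weight, since an admissible cube is a
    compact subset of [Omega]. *)
Definition in_cube (A : set (Rn R n)) :=
  exists2 c : Rn R n * R, F c & A `<=` cube c.1 c.2.

Lemma in_cube_cube c l : F (c, l) -> in_cube (cube c l).
Proof. by exists (c, l). Qed.

Lemma in_cubeS A B : A `<=` B -> in_cube B -> in_cube A.
Proof. by move=> AB [c Fc Bc]; exists c => //; exact: subset_trans Bc. Qed.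

Lemma in_cube_Omega A : in_cube A -> A `<=` Omega.
Proof.
by move=> [[c l] Fc Ac]; apply: (subset_trans Ac); exact: cubes_subset Fc.
Qed.

Section one_weight.
Context (w : Rn R n -> \bar R) (weight_w : weight Omega w).

Lemma wmeas_ge0 A : A `<=` Omega -> (0 <= wmeas w A)%E.
Proof. by move=> AO; apply: integral_ge0 => x /AO; case: weight_w => _ + _; exact. Qed.

Lemma wmeas_le A B : measurable A -> measurable B -> A `<=` B -> B `<=` Omega ->
  (wmeas w A <= wmeas w B)%E.
Proof.
move=> mA mB AB BO; have [mw w0 _] := weight_w.
apply: ge0_subset_integral => //.
  exact: measurable_funS mw.
by move=> x /BO; exact: w0.
Qed.

Lemma wmeas_setU A B : measurable A -> measurable B ->
  A `<=` Omega -> B `<=` Omega ->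
  (wmeas w (A `|` B) <= wmeas w A + wmeas w B)%E.
Proof.
move=> mA mB AO BO; have [mw w0 _] := weight_w.
have mBA : measurable (B `\` A) by exact: measurableD.
have BAO : B `\` A `<=` Omega by move=> x [/BO].
have -> : A `|` B = A `|` (B `\` A).
  apply/seteqP; split => x [Ax|]; try by left.
    by move=> Bx; have [Ax|nAx] := pselect (A x); [left|right].
  by move=> [Bx _]; right.
rewrite /wmeas ge0_integral_setU//.
- by apply: leeD => //; apply: wmeas_le => //; exact: subDsetl.
- by apply: measurable_funS mw => // x [/AO|/BAO].
- by move=> x [/AO|/BAO]; exact: w0.
- by rewrite disj_set2E setDIK.
Qed.

Lemma wmeas_sub (I : finType) (P : pred I) (B : I -> set (Rn R n)) A :
  measurable A -> (forall i, P i -> measurable (B i) /\ B i `<=` Omega) ->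
  (forall x, A x -> exists2 i, P i & B i x) ->
  (wmeas w A <= \sum_(i | P i) wmeas w (B i))%E.
Proof.
move=> mA mB AB.
pose U := \big[setU/set0]_(i | P i) B i.
have AU : A `<=` U.
  by move=> x /AB[i Pi Bx]; rewrite /U (bigD1 i)//=; left.
suff H : [/\ measurable U, U `<=` Omega & (wmeas w U <= \sum_(i | P i) wmeas w (B i))%E].
  by have [mU UO] := H; apply: le_trans; exact: wmeas_le.
rewrite /U; elim/big_ind2 : _ => //.
- by split => //; rewrite /wmeas integral_set0.
- move=> C x D y [mC CO Cx] [mD DO Dy]; split; first exact: measurableU.
    by move=> z [/CO|/DO].
  by apply: (le_trans (wmeas_setU _ _ _ _ _ _)) => //; exact: leeD.
- by move=> i /mB[? ?]; split.
Qed.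

Lemma wmeas_disj (I : finType) (P : pred I) (E : I -> set (Rn R n)) B :
  (forall i, P i -> measurable (E i) /\ E i `<=` B) -> measurable B ->
  (forall i j, P i -> P j -> i != j -> E i `&` E j = set0) ->
  B `<=` Omega -> (\sum_(i | P i) wmeas w (E i) <= wmeas w B)%E.
Proof.
move=> mE mB E0 BO; have [mw w0 _] := weight_w.
pose E' i := if P i then E i else set0.
have E'B i : E' i `<=` B by rewrite /E'; case: ifPn => [/mE[]//|_ x//].
have mE' i : measurable (E' i) by rewrite /E'; case: ifPn => [/mE[]//|_].
have UB : \big[setU/set0]_(i <- index_enum I) E' i `<=` B.
  by elim/big_ind : _ => // X Y XB YB z [/XB|/YB].
have mU : measurable (\big[setU/set0]_(i <- index_enum I) E' i).
  by apply: bigsetU_measurable.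
rewrite big_mkcond/= (_ : \sum_i _ = \sum_i wmeas w (E' i))%E; last first.
  apply: eq_bigr => i _; rewrite /E'; case: ifPn => // _.
  by rewrite /wmeas integral_set0.
rewrite /wmeas -ge0_integral_bigsetU//.
- exact: wmeas_le.
- exact: index_enum_uniq.
- move=> i j _ _ [x [/[dup]]]; rewrite /E'.
  case: ifPn => // Pi; case: ifPn => // Pj Ei _ Ej.
  apply/eqP/negPn/negP => ij; have := E0 _ _ Pi Pj ij.
  by rewrite -subset0 => /(_ x); apply; split.
- by apply: measurable_funS mw => //; exact: subset_trans BO.
- by move=> x /UB /BO; exact: w0.
Qed.

(** Real values, so that finite sums and real powers can be handled in R. They are meaningful for
    the measurable sets with [in_cube], where [wmeas] is finite. *)
Definition wmeasR A : R := fine (wmeas w A).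

Lemma wmeasR_ge0 A : A `<=` Omega -> 0 <= wmeasR A.
Proof. by move=> AO; rewrite fine_ge0// wmeas_ge0. Qed.

Lemma wmeasR0 : wmeasR set0 = 0.
Proof. by rewrite /wmeasR /wmeas integral_set0. Qed.

Lemma wmeas_fin A : measurable A -> in_cube A -> wmeas w A \is a fin_num.
Proof.
move=> mA [[c l] Fc Ac]; have AO := subset_trans Ac (cubes_subset _ _ beta01 _ _ Fc).
rewrite ge0_fin_numE ?wmeas_ge0//; have [_ _ wloc] := weight_w.
have l0 := cubes_gt0 _ _ _ _ Fc.
apply: (@le_lt_trans _ _ (wmeas w (cube c l))).
  by apply: wmeas_le => //; [exact: measurable_cube|exact: cubes_subset Fc].
by apply: wloc; [exact: cubes_subset Fc|exact: compact_cube].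
Qed.

Lemma wmeasRE A : measurable A -> in_cube A -> wmeas w A = (wmeasR A)%:E.
Proof. by move=> mA iA; rewrite /wmeasR fineK// wmeas_fin. Qed.

Lemma wmeasR_le A B : measurable A -> measurable B -> A `<=` B -> in_cube B ->
  wmeasR A <= wmeasR B.
Proof.
move=> mA mB AB iB; have iA := in_cubeS _ _ AB iB.
by rewrite -lee_fin -!wmeasRE// wmeas_le//; exact: in_cube_Omega.
Qed.

Lemma wmeasR_sub (I : finType) (P : pred I) (B : I -> set (Rn R n)) A :
  measurable A -> in_cube A -> (forall i, P i -> measurable (B i) /\ in_cube (B i)) ->
  (forall x, A x -> exists2 i, P i & B i x) ->
  wmeasR A <= \sum_(i | P i) wmeasR (B i).
Proof.
move=> mA iA mB AB; rewrite -lee_fin -wmeasRE// -sumEFin.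
rewrite (eq_bigr (fun i => wmeas w (B i))); last by move=> i /mB[? ?]; rewrite wmeasRE.
apply: wmeas_sub => // i /mB[? ?]; split => //; exact: in_cube_Omega.
Qed.

End one_weight.
End weights.

(** * Comparison of neighbouring cubes under doubling *)

Section comparison.
Context {R : realType} {n : nat}.
Local Notation mu := (@lebesgue_measure_Rn R n).
Local Notation N := n.+1.
Context (Omega : set (Rn R n)) (beta : R).
Context (Omega_proper : ~` Omega !=set0).
Context (Omega_measurable : measurable Omega) (beta01 : 0 < beta < 1).
Local Notation F := (cubes Omega beta).
Context (sigma : Rn R n -> \bar R) (weight_sigma : weight Omega sigma).
Context (D : R) (D_ge1 : 1 <= D).
Local Notation S c l := (wmeasR sigma (cube c l)).
Context (doubling_sigma : forall x l, F (x, 2 * l) -> S x (2 * l) <= D * S x l).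

Lemma cube_le c l z r : F (c, l) -> cube z r `<=` cube c l -> S z r <= S c l.
Proof.
move=> Fcl zc; apply: (wmeasR_le Omega beta) => //; try exact: measurable_cube.
exact: in_cube_cube.
Qed.

(* Points of Q(c, l) are at distance more than (1 / beta - 1) l from the
   complement of Omega, so the cubes of half side 2r centered at the points
   dividing [z, z'] into J equal parts are all admissible. *)
Lemma doubling_chain c l z z' r J : F (c, l) -> cube c l z -> cube c l z' -> 0 < r ->
  2 * r <= (1 - beta) * l -> (0 < J)%N -> 2 * l <= r * J%:R ->
  S z' r <= D ^+ J * S z r.
Proof.
move=> Fcl cz cz' r0 rl J0 lJ.
have J0R : 0 < J%:R :> R by rewrite ltr0n.
have D0 : 0 <= D by apply: le_trans D_ge1.
pose y j := z + (j%:R / J%:R) *: (z' - z).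
have y0 : y 0%N = z by rewrite /y mul0r scale0r addr0.
have yJ : y J = z' by rewrite /y divff ?gt_eqF// scale1r addrC subrK.
have cy j : (j <= J)%N -> cube c l (y j).
  by move=> jJ; apply: cube_segment => //; rewrite divr_ge0//= ler_pdivrMr// mul1r ler_nat.
have step j : `|y j - y j.+1| <= r.
  rewrite /y opprD addrACA subrr add0r -scalerBl -mulrBl.
  rewrite -[j.+1]addn1 natrD opprD addrA subrr add0r mulN1r scaleNr normrN.
  rewrite normrZ gtr0_norm ?invr_gt0// mulrC ler_pdivrMr//.
  by rewrite (le_trans _ lJ)// (cube_dist c).
clearbody y.
suff H j : (j <= J)%N -> S (y j) r <= D ^+ j * S z r by rewrite -yJ H.
elim: j => [_|j IH jJ]; first by rewrite y0 expr0 mul1r.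
(* Consecutive points are at most [r] apart, so Q(y_(j+1), r) lies in Q(y_j, 2r) and each step of
   the chain costs one doubling. *)
have Fy : F (y j, 2 * r).
  by apply: cubes_small Fcl (cy _ (ltnW jJ)) _ _ => //; rewrite mulr_gt0.
apply: (@le_trans _ _ (S (y j) (2 * r))).
  apply: cube_le Fy _; apply: cube_subset.
  by rewrite [leRHS]mulr_natl mulr2n lerD2r.
apply: (le_trans (doubling_sigma _ _ Fy)); rewrite exprS -mulrA.
apply: ler_wpM2l; first exact: D0.
exact/IH/ltnW.
Qed.

Lemma exists_natr_ge (x : R) : exists2 m, (0 < m)%N & x <= m%:R.
Proof.
exists (Num.trunc x).+1 => //; exact/ltW/truncnS_gt.
Qed.

(** Q(z, r) may stick out of Q(c, l). Enlarge it to half side (1 - beta) l, halve that at the cost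
    of one doubling, and follow a chain back to the center [c], where the cube lies in Q(c, l). The
    chain has about 4/(1 - beta) steps, hence the exponent [J.+1]. *)
Lemma doubling_upper : exists2 C, 1 <= C & forall c l z r,
  F (c, l) -> cube c l z -> 0 < r -> r <= (1 - beta) * l -> S z r <= C * S c l.
Proof.
have [b0 b1] := andP beta01.
have D0 : 0 < D by apply: lt_le_trans D_ge1.
have k0 : 0 < 1 - beta by rewrite subr_gt0.
have [J J0 HJ] := exists_natr_ge (4 / (1 - beta)).
exists (D ^+ J.+1); first by rewrite exprn_ege1.
move=> c l z r Fcl cz r0 rl; have l0 := cubes_gt0 _ _ _ _ Fcl.
set r1 := (1 - beta) * l / 2.
have r1E : 2 * r1 = (1 - beta) * l by rewrite /r1; field.
have r10 : 0 < r1 by rewrite /r1 divr_gt0// mulr_gt0.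
have Fz : F (z, 2 * r1) by apply: cubes_small Fcl _ _ _ => //; rewrite r1E ?mulr_gt0.
apply: (@le_trans _ _ (S z (2 * r1))).
  by apply: cube_le => //; apply: cube_subset; rewrite subrr normr0 r1E add0r.
rewrite (le_trans (doubling_sigma _ _ Fz))// exprS -mulrA ler_wpM2l ?(ltW D0)//.
apply: (@le_trans _ _ (D ^+ J * S c r1)).
  apply: (doubling_chain c l) => //; [exact/cube_center/ltW|by rewrite r1E|].
  rewrite /r1; move: HJ; rewrite ler_pdivrMr// => HJ.
  have : l * 4 <= l * (J%:R * (1 - beta)) by rewrite ler_pM2l.
  lra.
rewrite ler_wpM2l ?exprn_ge0 ?(ltW D0)//; apply: cube_le => //.
apply: cube_subset; rewrite subrr normr0 add0r /r1.
have : (1 - beta) * l <= l by rewrite ler_piMl ?ltW//; lra.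
lra.
Qed.

(** Tiles of half side at most eta l / 2 cover Q(c, l), and a chain compares each of them with Q(z,
    eta l / 2), which lies in Q(z, r). The bound on [eta] keeps the chains admissible; the constant
    counts the tiles. *)
Lemma doubling_lower eta : 0 < eta -> eta <= 1 - beta -> exists2 C, 1 <= C &
  forall c l z r, F (c, l) -> cube c l z -> eta * l <= r -> F (z, r) ->
    S c l <= C * S z r.
Proof.
move=> eta0 etak; have [b0 b1] := andP beta01.
have D0 : 0 < D by apply: lt_le_trans D_ge1.
have [J J0 HJ] := exists_natr_ge (4 / eta).
have [m m0 Hm] := exists_natr_ge (2 / eta).
pose T := {ffun 'I_N -> 'I_(2 * m).+1}.
have T0 : (0 < #|T|)%N by apply/card_gt0P; exists [ffun=> ord0].
exists (#|T|%:R * D ^+ J).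
  by rewrite -[leLHS]mulr1 ler_pM// ?ler1n// exprn_ege1.
move=> c l z r Fcl cz rl Fz; have l0 := cubes_gt0 _ _ _ _ Fcl.
have m0R : 0 < m%:R :> R by rewrite ltr0n.
set r1 := eta * l / 2.
have r1E : 2 * r1 = eta * l by rewrite /r1; field.
have r10 : 0 < r1 by rewrite /r1 divr_gt0// mulr_gt0.
have r1l : 2 * r1 <= (1 - beta) * l by rewrite r1E ler_pM2r.
have lm : l / m%:R <= r1.
  rewrite ler_pdivrMr// /r1; move: Hm; rewrite ler_pdivrMr// => Hm.
  have : l * 2 <= l * (m%:R * eta) by rewrite ler_pM2l.
  lra.
have lm0 : 0 < l / m%:R by rewrite divr_gt0.
have Ft (k : T) : F (tile c l m k, r1).
  by apply: cubes_small Fcl _ _ _ => //; [exact: tile_center|lra].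
have Ft' (k : T) : F (tile c l m k, l / m%:R) by apply: cubes_shrink (Ft k) _ _.
apply: (@le_trans _ _ (\sum_(k : T) S (tile c l m k) (l / m%:R))).
  apply: (wmeasR_sub Omega beta) => //.
  - exact: measurable_cube.
  - exact: in_cube_cube.
  - by move=> k _; split; [exact: measurable_cube|exact: in_cube_cube].
  - by move=> x cx; have [k kx] := tile_cover _ _ _ _ l0 m0 cx; exists k.
apply: (@le_trans _ _ (\sum_(k : T) D ^+ J * S z r)); last first.
  by rewrite big_const iter_addr_0 -mulrA mulr_natl.
apply: ler_sum => k _.
apply: (@le_trans _ _ (S (tile c l m k) r1)).
  by apply: cube_le => //; apply: cube_subset; rewrite subrr normr0 add0r.
apply: (@le_trans _ _ (D ^+ J * S z r1)).
  apply: (doubling_chain c l) => //; first exact: tile_center.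
  rewrite /r1; move: HJ; rewrite ler_pdivrMr// => HJ.
  have : l * 4 <= l * (J%:R * eta) by rewrite ler_pM2l.
  lra.
rewrite ler_wpM2l ?exprn_ge0 ?(ltW D0)//; apply: cube_le => //.
by apply: cube_subset; rewrite subrr normr0 add0r; lra.
Qed.

End comparison.

(** * Selection of disjoint cubes and the local estimate *)

(** Greedy choice: take an element of largest [rad], discard everything that meets it, and repeat.
    Reflexivity makes the remaining set strictly smaller. In place of a covering by dilated cubes,
    each index is charged to a selected one that it meets and that is at least as large. *)
Lemma vitali_selection (R : realType) (I : finType) (rad : I -> R) (meets : rel I)
    (G : {set I}) : symmetric meets -> reflexive meets ->
  exists A : {set I}, [/\ A \subset G,
    (forall i j, i \in A -> j \in A -> i != j -> ~~ meets i j) &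
    forall i, i \in G -> exists2 s, s \in A & meets i s && (rad i <= rad s)].
Proof.
move=> msym mrefl; move En : #|G| => k.
elim/ltn_ind : k G En => k IH G En.
have [->|[i0 i0G]] := set_0Vmem G.
  by exists finset.set0; split => // i; rewrite ?inE.
have [s0 s0G s0max] : exists2 s0, s0 \in G & forall i, i \in G -> rad i <= rad s0.
  by case: (arg_maxP rad i0G) => s0 s0G H; exists s0.
pose G' : {set I} := [set i in G | ~~ meets i s0]%SET.
have [|A [AG' Adisj Acov]] := IH _ _ G' erefl.
  rewrite -En; apply: proper_card; apply/properP; split.
    by apply/fintype.subsetP => i; rewrite inE => /andP[].
  by exists s0 => //; rewrite inE mrefl andbF.
have AG i : i \in A -> (i \in G) && ~~ meets i s0.
  by move=> /(fintype.subsetP AG'); rewrite inE.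
exists (s0 |: A)%SET; split.
- apply/fintype.subsetP => i; rewrite !inE => /orP[/eqP->//|/AG/andP[]//].
- move=> i j; rewrite !inE => /orP[/eqP->|iA] /orP[/eqP->|jA]; rewrite ?eqxx//.
  + by rewrite msym; have /andP[] := AG _ jA.
  + by have /andP[] := AG _ iA.
  + exact: Adisj.
- move=> i iG; have [ms|nms] := boolP (meets i s0).
    by exists s0; rewrite ?inE ?eqxx// ms s0max.
  have [|s sA H] := Acov i; first by rewrite inE iG.
  by exists s => //; rewrite inE sA orbT.
Qed.

Section local_estimate.
Context {R : realType} {n : nat}.
Local Notation mu := (@lebesgue_measure_Rn R n).
Local Notation N := n.+1.
Context (Omega : set (Rn R n)) (beta : R).
Context (Omega_proper : ~` Omega !=set0).
Context (Omega_measurable : measurable Omega) (beta01 : 0 < beta < 1).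
Local Notation F := (cubes Omega beta).
Context (sigma u : Rn R n -> \bar R).
Context (weight_sigma : weight Omega sigma) (weight_u : weight Omega u).
Context (D : R) (D_ge1 : 1 <= D).
Local Notation S c l := (wmeasR sigma (cube c l)).
Context (doubling_sigma : forall x l, F (x, 2 * l) -> S x (2 * l) <= D * S x l).
Context (S_gt0 : forall c l, F (c, l) -> 0 < S c l).
Context (V0 : R) (V0_gt0 : 0 < V0).

(** The average over a cube, with |Q| written as the N-th power of the half side times [V0], later
    the measure of the cube of half side 1. It is used for [sigma] and for |f|. *)
Definition density (Q : Rn R n * R) : R :=
  wmeasR sigma (cube Q.1 Q.2) / (Q.2 ^+ N * V0).

Context (q rr : R) (q_gt0 : 0 < q) (rr_gt0 : 0 < rr).
Context (K : R) (K_ge0 : 0 <= K).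

(** The predicate [P] allows passing to subfamilies without reindexing. *)
Definition admissible_family {I : finType} (P : pred I) (E : I -> set (Rn R n))
    (Q : I -> Rn R n * R) :=
  (forall i, P i -> [/\ F (Q i), measurable (E i) & E i `<=` cube (Q i).1 (Q i).2]) /\
  (forall i j, P i -> P j -> i != j -> E i `&` E j = set0).

(** Discrete form of the testing condition, raised to the power [q]; it is derived in [testing_sum]
    and used with [rr] equal to q/p. *)
Context (testing : forall (J : nat) (P : pred 'I_J) (E : 'I_J -> set (Rn R n))
  (Q : 'I_J -> Rn R n * R) (c : Rn R n) (l : R), F (c, l) ->
  admissible_family P E Q -> (forall i, P i -> cube (Q i).1 (Q i).2 `<=` cube c l) ->
  \sum_(i < J | P i) wmeasR u (E i) * density (Q i) `^ q <= K * S c l `^ rr).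

Lemma le_powR (x y a : R) : 0 <= a -> 0 <= x -> x <= y -> x `^ a <= y `^ a.
Proof. by move=> a0 x0 xy; rewrite ge0_ler_powR// ?nnegrE// (le_trans x0). Qed.

(* Tile 3Q(c, l) by cubes t of half side at most [eta * l].  The cubes Q_i of
   half side at most [del * l] that meet t lie in one admissible cube of half
   side [kap * l] centered in Q(c, l), to which the testing condition applies.
   The remaining Q_i are comparable to Q(c, l), and if one of them meets t,
   then t lies in an admissible cube comparable to Q(c, l) as well. *)
Lemma local_estimate : exists2 C, 0 <= C & forall (J : nat) (P : pred 'I_J)
  (E : 'I_J -> set (Rn R n)) (Q : 'I_J -> Rn R n * R) c l, F (c, l) ->
  admissible_family P E Q ->
  (forall i, P i -> cube (Q i).1 (Q i).2 `&` cube c l !=set0 /\ (Q i).2 <= l) ->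
  \sum_(i < J | P i) wmeasR u (E i) * density (Q i) `^ q <= C * S c l `^ rr.
Proof.
have [b0 b1] := andP beta01.
set kap := 1 - beta; have k0 : 0 < kap by rewrite /kap subr_gt0.
have k1 : kap <= 1 by rewrite /kap; lra.
(* Small cubes that meet a common tile reach at most (2 del + eta + 2 del) l <= 5 del l away from a
   point of one of them, within [kap * l]. With [eta = kap * del], every cube of half side above
   [del * l] admits cubes of half side [eta * l] centered in it. *)
pose del := kap / 6; have del0 : 0 < del by rewrite /del; lra.
pose eta := kap * del.
have eta0 : 0 < eta by rewrite mulr_gt0.
have etad : eta <= del by rewrite /eta ler_piMl// ltW.
have etak : eta <= kap by rewrite (le_trans etad)// /del; lra.
have [C1 C1_ge1 upper] := doubling_upper _ _ Omega_proper Omega_measurable beta01 _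
  weight_sigma _ D_ge1 doubling_sigma.
have [C2 C2_ge1 lower] := doubling_lower _ _ Omega_proper Omega_measurable beta01 _
  weight_sigma _ D_ge1 doubling_sigma _ eta0 etak.
have C1_gt0 : 0 < C1 by apply: lt_le_trans C1_ge1.
have C2_gt0 : 0 < C2 by apply: lt_le_trans C2_ge1.
(* The tiles of 3Q have half side 3l/m, so this choice makes their diameter at most [eta * l]. *)
have [m m0 Hm] := exists_natr_ge (6 / eta).
have m0R : 0 < m%:R :> R by rewrite ltr0n.
pose T := {ffun 'I_N -> 'I_(2 * m).+1}.
pose Ksmall := K * C1 `^ rr.
(* The first product compares Q_i with Q(c, l), then with a fixed large cube Q_j, then with Q(z, eta
   l), z in Q_j; the second leads from Q(z, eta l) over Q_j back to Q(c, l). *)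
pose Klarge := (C2 * C1 * C2 * C1 * C2) `^ q * K * (C1 * C2 * C1) `^ rr.
have Ks0 : 0 <= Ksmall by rewrite mulr_ge0 ?powR_ge0.
have Kl0 : 0 <= Klarge by rewrite !mulr_ge0 ?powR_ge0.
exists (#|T|%:R * (Ksmall + Klarge)); first by rewrite mulr_ge0 ?addr_ge0.
move=> J P E Q c l Fcl [HE Edisj] HQ; have l0 := cubes_gt0 _ _ _ _ Fcl.
pose t (k : T) : set (Rn R n) := cube (tile c (3 * l) m k) (3 * l / m%:R).
have tdiam (k : T) x y : t k x -> t k y -> `|x - y| <= eta * l.
  move=> tx ty; rewrite (le_trans (cube_dist _ _ _ _ tx ty))// mulrA ler_pdivrMr//.
  move: Hm; rewrite ler_pdivrMr// => Hm.
  have : l * 6 <= l * (m%:R * eta) by rewrite ler_pM2l.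
  lra.
have mt k : measurable (t k) by exact: measurable_cube.
have Qin i x : P i -> cube (Q i).1 (Q i).2 x -> cube c (3 * l) x.
  move=> Pi Qx; have [[y [Qy cy]] li] := HQ i Pi.
  rewrite /cube /= -(subrK y c) -addrA (le_trans (ler_normD _ _))//.
  by have := cube_dist _ _ _ _ Qy Qx; move: cy; rewrite /cube /=; lra.
have dens_ge0 i : P i -> 0 <= density (Q i).
  move=> Pi; have [FQ _ _] := HE i Pi.
  rewrite /density divr_ge0//.
    by rewrite (wmeasR_ge0 Omega)//; exact: in_cube_Omega (in_cube_cube _ _ _ _ FQ).
  by rewrite mulr_ge0 ?(ltW V0_gt0)// exprn_ge0// ltW// (cubes_gt0 _ _ _ _ FQ).
pose a i := density (Q i) `^ q.
have a_ge0 i : 0 <= a i by exact: powR_ge0.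
pose U i k := wmeasR u (E i `&` t k).
have tF i k : P i -> in_cube Omega beta (E i `&` t k).
  by move=> Pi; have [FQ _ EQ] := HE i Pi; exists (Q i) => // x [/EQ].
have mEt i k : P i -> measurable (E i `&` t k).
  by move=> Pi; have [_ mE _] := HE i Pi; exact: measurableI.
have U_ge0 i k : P i -> 0 <= U i k.
  by move=> Pi; apply: (wmeasR_ge0 Omega) => //; apply: (@in_cube_Omega _ _ _ beta) => //; exact: tF.
apply: (@le_trans _ _ (\sum_(k : T) \sum_(i < J | P i) U i k * a i)).
  rewrite exchange_big/=; apply: ler_sum => i Pi.
  rewrite -mulr_suml ler_wpM2r ?powR_ge0//; have [FQ mE EQ] := HE i Pi.
  apply: (wmeasR_sub Omega beta Omega_measurable beta01 _ weight_u _ xpredT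
    (fun k => E i `&` t k)) => //; first by exists (Q i).
    by move=> k _; split; [exact: mEt|exact: tF].
  move=> x Ex; have l30 : 0 < 3 * l by rewrite mulr_gt0.
  by have [k kx] := tile_cover _ _ _ _ l30 m0 (Qin _ _ Pi (EQ _ Ex)); exists k.
rewrite -mulrA mulr_natl -sumr_const; apply: ler_sum => k _.
pose hit i := `[< E i `&` t k !=set0 >].
have hitE (P' : pred 'I_J) : \sum_(i < J | P' i) U i k * a i =
    \sum_(i < J | P' i && hit i) U i k * a i.
  rewrite (bigID hit)/= [X in _ + X]big1 ?addr0// => i /andP[_ /asboolPn nh].
  suff -> : U i k = 0 by rewrite mul0r.
  rewrite /U (_ : _ `&` _ = set0) ?wmeasR0//; apply/seteqP; split => // x Ex.
  by case: nh; exists x.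
pose small i := (Q i).2 <= del * l.
have famEt (P' : pred 'I_J) : (forall i, P' i -> P i) ->
    forall i j, P' i -> P' j -> i != j -> (E i `&` t k) `&` (E j `&` t k) = set0.
  move=> P'P i j /P'P Pi /P'P Pj ij; apply/seteqP; split => // x [[Ei _] [Ej _]].
  by rewrite -(Edisj i j Pi Pj ij).
rewrite (bigID small)/= mulrDl; apply: lerD; rewrite hitE.
- have [/existsP[i0 /andP[/andP[Pi0 small0] /asboolP[y0 [E0 t0]]]]|] :=
      boolP [exists i, (P i && small i) && hit i]; last first.
    rewrite negb_exists => /forallP H; rewrite big1 ?mulr_ge0 ?powR_ge0//.
    by move=> i Hi; have := H i; rewrite Hi.
  have [FQ0 _ EQ0] := HE i0 Pi0.
  (* The test cube is centered at a common point of one small cube and Q(c, l): membership in Q(c,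
     l) makes it admissible, membership in Q_(i0) places it near the tile. *)
  have [[z' [Qz' cz']] _] := HQ i0 Pi0.
  have kl0 : 0 < kap * l by rewrite mulr_gt0.
  have FR : F (z', kap * l) by exact: cubes_small Fcl _ _ _.
  have := testing J (fun i => P i && small i && hit i) (fun i => E i `&` t k) Q z' (kap * l) FR.
  move=> H; apply: (le_trans (H _ _)).
  + split; last by apply: famEt => i /andP[/andP[]].
    move=> i /andP[/andP[Pi _] _]; have [FQ _ EQ] := HE i Pi.
    by split => //; [exact: mEt|move=> x [/EQ]].
  + move=> i /andP[/andP[Pi smalli] /asboolP[y [Ey ty]]].
    have [FQ _ EQ] := HE i Pi; apply: cube_subset.
    have H1 := cube_dist _ _ _ _ Qz' (EQ0 _ E0).
    have H2 := tdiam _ _ _ t0 ty.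
    have H3 : `|y - (Q i).1| <= (Q i).2 by rewrite distrC; exact: EQ Ey.
    have H4 : eta * l <= del * l by rewrite ler_pM2r.
    have -> : z' - (Q i).1 = (z' - y0) + (y0 - y) + (y - (Q i).1).
      by rewrite !addrA !subrK.
    apply: (@le_trans _ _ (2 * (Q i0).2 + eta * l + (Q i).2 + (Q i).2)).
      rewrite lerD2r (le_trans (ler_normD _ _))// lerD//.
      by rewrite (le_trans (ler_normD _ _))// lerD.
    have -> : kap * l = 6 * (del * l) by rewrite /del; field.
    have dl0 : 0 < del * l by rewrite mulr_gt0.
    by move: small0 smalli; rewrite /small; lra.
  + rewrite /Ksmall -mulrA ler_wpM2l// -powRM ?(ltW (S_gt0 _ _ Fcl))// ?(ltW C1_gt0)//.
    apply: le_powR; [exact: ltW|exact/ltW/S_gt0|].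
    by apply: upper.
- have [/existsP[j /andP[/andP[Pj largej] /asboolP[z [Ez tz]]]]|] :=
      boolP [exists i, (P i && ~~ small i) && hit i]; last first.
    rewrite negb_exists => /forallP H; rewrite big1 ?mulr_ge0 ?powR_ge0//.
    by move=> i Hi; have := H i; rewrite Hi.
  have el0 : 0 < eta * l by rewrite mulr_gt0.
  have elk : eta * l <= kap * l by rewrite ler_pM2r.
  have large i : ~~ small i -> eta * l <= kap * (Q i).2.
    by rewrite /small -ltNge => H; rewrite /eta -mulrA ler_pM2l// ltW.
  (* Both comparisons pass through Q(zi, eta l), where zi is a common point of Q_i and Q(c, l). *)
  have comp i : P i -> ~~ small i ->
      wmeasR sigma (cube (Q i).1 (Q i).2) <= C2 * C1 * S c l /\
      S c l <= C2 * C1 * wmeasR sigma (cube (Q i).1 (Q i).2).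
    move=> Pi li; have [FQ _ EQ] := HE i Pi; have [[zi [Qzi czi]] lil] := HQ i Pi.
    have FQ' : F ((Q i).1, (Q i).2) by case: (Q i) FQ.
    have Fzi : F (zi, eta * l) by apply: cubes_small FQ' _ _ _ => //; exact: large.
    split; rewrite -mulrA.
      apply: (le_trans (lower _ _ _ _ FQ' Qzi _ Fzi)); first by rewrite ler_pM2l.
      by rewrite ler_pM2l//; exact: upper.
    apply: (le_trans (lower _ _ _ _ Fcl czi _ Fzi)) => //.
    by rewrite ler_pM2l//; apply: upper => //; exact: large.
  have [FQj _ EQj] := HE j Pj; have FQj' : F ((Q j).1, (Q j).2) by case: (Q j) FQj.
  have Qz := EQj _ Ez.
  have Fz : F (z, eta * l) by apply: cubes_small FQj' _ _ _ => //; exact: large.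
  have [ljS Slj] := comp j Pj largej; have [_ lj] := HQ j Pj.
  have jz : wmeasR sigma (cube (Q j).1 (Q j).2) <= C2 * S z (eta * l).
    by apply: lower => //; rewrite ler_pM2l.
  have zj : S z (eta * l) <= C1 * wmeasR sigma (cube (Q j).1 (Q j).2).
    by apply: upper => //; exact: large.
  have Szl : S z (eta * l) <= C1 * C2 * C1 * S c l.
    by rewrite (le_trans zj)// -!mulrA ler_pM2l// mulrA.
  have Sdens i : P i -> ~~ small i ->
      density (Q i) <= C2 * C1 * C2 * C1 * C2 * density (z, eta * l).
    move=> Pi li; have [FQ _ _] := HE i Pi; have [liS _] := comp i Pi li.
    have li0 : 0 < (Q i).2 by case: FQ.
    have eli : eta * l <= (Q i).2.
      rewrite (@le_trans _ _ (del * l)) ?ler_pM2r//.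
      by move: li; rewrite /small -ltNge => /ltW.
    rewrite /density/= mulrA; apply: ler_pM.
    + exact/ltW/S_gt0.
    + by rewrite invr_ge0 mulr_ge0 ?exprn_ge0 ?ltW.
    + move: jz; move: (S z (eta * l)) => Sz jz.
      apply: (le_trans liS); rewrite -!mulrA !ler_pM2l//.
      by rewrite (le_trans Slj)// -!mulrA !ler_pM2l.
    + rewrite lef_pV2 ?posrE ?mulr_gt0 ?exprn_gt0// ler_pM2r//.
      by rewrite lerXn2r// nnegrE ltW.
  (* All large cubes are replaced by the single cube Q(z, eta l), which contains the tile and hence
     the disjoint sets to be tested. [Sdens] pays for the change of densities. *)
  have := testing J (fun i => P i && ~~ small i && hit i) (fun i => E i `&` t k)
    (fun=> (z, eta * l)) z (eta * l) Fz.
  move=> H; apply: (@le_trans _ _ ((C2 * C1 * C2 * C1 * C2) `^ q *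
      \sum_(i < J | P i && ~~ small i && hit i) U i k * density (z, eta * l) `^ q)).
    rewrite mulr_sumr; apply: ler_sum => i /andP[/andP[Pi li] _].
    rewrite mulrCA ler_wpM2l ?U_ge0// -powRM; last 2 first.
    + by rewrite !mulr_ge0// ltW.
    + by rewrite divr_ge0 ?mulr_ge0 ?exprn_ge0 ?ltW// S_gt0.
    by apply: le_powR; [exact: ltW|exact: dens_ge0|exact: Sdens].
  rewrite /Klarge -[leRHS]mulrA -[leRHS]mulrA ler_wpM2l ?powR_ge0//; apply: (le_trans (H _ _)).
  + split; last by apply: famEt => i /andP[/andP[]].
    move=> i /andP[/andP[Pi _] _]; split => //; first exact: mEt.
    move=> x [_ tx]; exact: tdiam tz tx.
  + by move=> i _ x.
  + rewrite ler_wpM2l// -powRM ?(ltW (S_gt0 _ _ Fcl))//; last by rewrite !mulr_ge0// ltW.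
    by apply: le_powR; [exact: ltW|exact/ltW/S_gt0|exact: Szl].
Qed.

(** Each cube is charged to a selected one that it meets and whose half side is not smaller;
    [local_estimate] bounds the total charge of each selected cube. *)
Lemma selection_estimate : exists2 C, 0 <= C & forall (J : nat) (P : pred 'I_J)
  (E : 'I_J -> set (Rn R n)) (Q : 'I_J -> Rn R n * R),
  admissible_family P E Q ->
  exists A : {set 'I_J}, [/\ forall i, i \in A -> P i,
    forall i j, i \in A -> j \in A -> i != j ->
      cube (Q i).1 (Q i).2 `&` cube (Q j).1 (Q j).2 = set0 &
    \sum_(i < J | P i) wmeasR u (E i) * density (Q i) `^ q <=
    C * \sum_(s in A) wmeasR sigma (cube (Q s).1 (Q s).2) `^ rr].
Proof.
have [C C0 HC] := local_estimate; exists C => // J P E Q fam.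
(* Equality is added because reflexivity is required for all indices, and a cube outside [P] may be
   empty. *)
pose meets (i j : 'I_J) := (i == j) ||
  `[< cube (Q i).1 (Q i).2 `&` cube (Q j).1 (Q j).2 !=set0 >].
have msym : symmetric meets by move=> i j; rewrite /meets eq_sym setIC.
have mrefl : reflexive meets by move=> i; rewrite /meets eqxx.
have [A [AP Adisj Acov]] := vitali_selection _ _ (fun i => (Q i).2) _ [set i | P i]%SET msym mrefl.
have PA i : i \in A -> P i by move=> /(fintype.subsetP AP); rewrite inE.
exists A; split => //.
  move=> i j iA jA ij; have := Adisj _ _ iA jA ij.
  rewrite negb_or => /andP[_ /asboolPn H]; apply/seteqP; split => // x Hx.
  by case: H; exists x.
have [HE Edisj] := fam.
pose om i := wmeasR u (E i) * density (Q i) `^ q.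
have om_ge0 i : P i -> 0 <= om i.
  move=> Pi; rewrite mulr_ge0 ?powR_ge0//; apply: (wmeasR_ge0 Omega) => //.
  by have [FQ mE EQ] := HE i Pi; apply: (@in_cube_Omega _ _ _ beta) => //; exists (Q i).
pose near s i := meets i s && ((Q i).2 <= (Q s).2).
apply: (@le_trans _ _ (\sum_(s in A) \sum_(i < J | P i && near s i) om i)).
  rewrite (exchange_big_dep P)/=; last by move=> i j _ /andP[].
  apply: ler_sum => i Pi; have [|s sA si] := Acov i; first by rewrite inE.
  rewrite (bigD1 s)/=; last by rewrite sA Pi.
  by rewrite lerDl sumr_ge0// => j _; exact: om_ge0.
rewrite mulr_sumr; apply: ler_sum => s sA; have Ps := PA _ sA.
have [FQ _ EQ] := HE s Ps; apply: HC.
- by case: (Q s) FQ.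
- split; first by move=> i /andP[Pi _]; exact: HE.
  by move=> i j /andP[Pi _] /andP[Pj _]; exact: Edisj.
- move=> i /andP[Pi /andP[/orP[/eqP->|/asboolP H] ->]]; split => //.
  by exists (Q s).1; split; apply: cube_center; case: FQ => _ /ltW.
Qed.


End local_estimate.

(** * Dyadic levels *)

Section levels.
Context {R : realType}.
Context (a t0 : R) (a_gt0 : 0 < a) (t0_gt0 : 0 < t0).

Definition level (j : nat) : R := t0 * 2 ^+ j.

Lemma level_gt0 j : 0 < level j.
Proof. by rewrite mulr_gt0// exprn_gt0. Qed.

(* Sum of the geometric series of ratio [2 `^ (- a)]. *)
Definition geometric_const : R := 2 `^ a / (2 `^ a - 1).

Lemma two_powR_gt1 : 1 < (2 : R) `^ a.
Proof.
suff : (1 : R) `^ a < 2 `^ a by rewrite powR1.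
by apply: gt0_ltr_powR; rewrite ?nnegrE// ltr1n.
Qed.

Lemma geometric_const_gt0 : 0 < geometric_const.
Proof. by have := two_powR_gt1 => b1; rewrite divr_gt0 ?subr_gt0// (lt_trans _ b1). Qed.

(** With b = 2^a, the constant B satisfies B + b = B b, which is exactly the induction step. *)
Lemma level_geometric m : \sum_(j < m.+1) level j `^ a <= geometric_const * level m `^ a.
Proof.
have b1 := two_powR_gt1; set b := 2 `^ a in b1.
have b0 : 0 < b by rewrite (lt_trans _ b1).
have B1 : 1 <= geometric_const.
  by rewrite /geometric_const -/b ler_pdivlMr ?subr_gt0// mul1r; lra.
elim: m => [|m IH]; first by rewrite big_ord_recl big_ord0 addr0 ler_peMl ?powR_ge0.
rewrite big_ord_recr/= (le_trans (lerD IH (lexx _)))//.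
have -> : level m.+1 `^ a = b * level m `^ a.
  have -> : level m.+1 = 2 * level m by rewrite /level exprS mulrCA.
  by rewrite powRM ?ler0n//; exact/ltW/level_gt0.
have -> : geometric_const * (b * level m `^ a) = (geometric_const * b) * level m `^ a by rewrite mulrA.
rewrite -mulrDl ler_wpM2r ?powR_ge0//.
have bE : geometric_const * (b - 1) = b by rewrite /geometric_const -/b divfK// gt_eqF// subr_gt0.
by move: bE; rewrite mulrBr mulr1 => bE; lra.
Qed.

Lemma level_sum m h : 0 <= h ->
  \sum_(j < m | level j < h) level j `^ a <= geometric_const * h `^ a.
Proof.
move=> h0; elim: m => [|m IH].
  by rewrite big_ord0 mulr_ge0 ?powR_ge0// ltW// geometric_const_gt0.
rewrite big_mkcond big_ord_recr/= -big_mkcond/=; case: ifPn => [mh|_]; last by rewrite addr0.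
apply: (@le_trans _ _ (\sum_(j < m.+1) level j `^ a)).
  by rewrite big_ord_recr/= lerD2r big_mkcond/= ler_sum// => i _; case: ifP; rewrite ?powR_ge0.
apply: (le_trans (level_geometric m)); rewrite ler_wpM2l ?(ltW geometric_const_gt0)//.
by rewrite le_powR ?(ltW a_gt0)// ltW// level_gt0.
Qed.

End levels.

(** Superadditivity of the power: (y + z)^r = y (y + z)^(r-1) + z (y + z)^(r-1) >= y^r + z^r. *)
Lemma sum_powR_le (R : realType) (I : finType) (P : pred I) (x : I -> R) (r : R) :
  1 <= r -> (forall i, P i -> 0 <= x i) ->
  \sum_(i | P i) x i `^ r <= (\sum_(i | P i) x i) `^ r.
Proof.
move=> r1 x0; have r0 : 0 < r by apply: lt_le_trans r1.
suff : 0 <= \sum_(i | P i) x i /\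
  \sum_(i | P i) x i `^ r <= (\sum_(i | P i) x i) `^ r by case.
elim/big_ind2 : _ => [|y1 y z1 z [y0 yr] [z0 zr]|i /x0 xi0].
- by rewrite powR0 ?gt_eqF.
- split; first exact: addr_ge0.
  apply: (le_trans (lerD yr zr)).
  rewrite -[in leRHS](mulr_powRB1 (addr_ge0 y0 z0) r0) mulrDl.
  by rewrite lerD// -{1}mulr_powRB1// ler_wpM2l// le_powR ?subr_ge0 ?lerDl ?lerDr.
- by [].
Qed.

(** * The dual weight at a single point *)

Section pointwise.
Context {R : realType}.
Context (p : R) (p_gt1 : 1 < p).
Let a := p - 1.
Let a_gt0 : 0 < a. Proof. by rewrite /a subr_gt0. Qed.

Lemma dual_exponentE : 1 - p / (p - 1) = - a^-1.
Proof. by rewrite /a; field; rewrite subr_eq0 gt_eqF. Qed.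

(** The value v = 0 is excluded because [wpow] sends it to [+oo] for a negative exponent. *)
Lemma dual_weight (v : \bar R) : (0 <= v < +oo)%E ->
  (wpow v (1 - p / (p - 1)) < +oo)%E ->
  exists2 w : R, 0 < w & v = w%:E /\
    wpow v (1 - p / (p - 1)) = ((w `^ a^-1)^-1)%:E.
Proof.
rewrite dual_exponentE /wpow oppr_lt0 invr_gt0 a_gt0 opprK.
case: v => [w|/andP[_]|/andP[]]; rewrite ?ltxx// lee_fin => /andP[w0 _] woo.
have w_gt0 : 0 < w.
  rewrite lt_neqAle w0 andbT eq_sym; apply/eqP => weq; move: woo.
  by rewrite weq poweR0r ?invr_eq0 ?gt_eqF// inve0.
exists w => //; split => //.
by rewrite poweR_EFin inver gt_eqF// powR_gt0.
Qed.

(** This is sigma^(p-1) = 1/v, the source of the pointwise estimates below. *)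
Lemma dual_weight_powR (w : R) : 0 < w -> ((w `^ a^-1)^-1) `^ a = w^-1.
Proof.
move=> w0; rewrite -powR_inv1 ?powR_ge0// -!powRrM.
by rewrite mulNr mul1r mulrN mulVf ?gt_eqF// powR_inv1// ltW.
Qed.

(** Equality holds where [v] and its dual are finite. At v = 0 the left side is 0 and the right side
    [+oo], at v = +oo both sides vanish. *)
Lemma dual_weight_le (v : \bar R) : (0 <= v)%E ->
  (wpow v (1 - p / (p - 1)) `^ p * v <= wpow v (1 - p / (p - 1)))%E.
Proof.
move=> v0; have p0 : 0 < p by rewrite (lt_trans _ p_gt1).
have [voo|] := boolP (v < +oo)%E; last first.
  rewrite -leNgt leye_eq => /eqP ->.
  rewrite dual_exponentE /wpow oppr_lt0 invr_gt0 a_gt0 opprK.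
  by rewrite poweRyr ?invr_eq0 ?gt_eqF// invey poweR0r ?gt_eqF// mul0e.
have [|] := boolP (wpow v (1 - p / (p - 1)) < +oo)%E; last first.
  by rewrite -leNgt leye_eq => /eqP ->; rewrite leey.
move=> /(dual_weight v); rewrite v0 voo => /(_ isT)[w w0 [-> ->]].
rewrite poweR_EFin -EFinM lee_fin -mulr_powRB1 ?invr_ge0 ?powR_ge0//.
by rewrite dual_weight_powR// -mulrA mulVf ?gt_eqF// mulr1.
Qed.

(** If y exceeds sigma, then y = y^p y^(1-p) <= y^p sigma^(1-p) = y^p v. Integrated, this makes
    functions of L^p(v) locally integrable. *)
Lemma le_dual_weightD (v y : \bar R) : (0 <= v < +oo)%E -> (0 <= y)%E ->
  (wpow v (1 - p / (p - 1)) < +oo)%E ->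
  (y <= wpow v (1 - p / (p - 1)) + y `^ p * v)%E.
Proof.
have p0 : 0 < p by rewrite (lt_trans _ p_gt1).
move=> vb y0 /(dual_weight v vb)[w w0 [-> ->]].
case: y y0 => [y| |]//; last first.
  by rewrite poweRyr ?gt_eqF// gt0_mulye ?lte_fin.
rewrite lee_fin => y0; rewrite poweR_EFin -EFinM -EFinD lee_fin.
set s := (w `^ a^-1)^-1; have s0 : 0 < s by rewrite invr_gt0 powR_gt0.
have [ys|sy] := leP y s; first by rewrite (le_trans ys)// lerDl mulr_ge0 ?powR_ge0// ltW.
rewrite -[leLHS]add0r lerD ?(ltW s0)// -mulr_powRB1// -mulrA ler_peMr//.
rewrite -ler_pdivrMr// mul1r -dual_weight_powR//.
by rewrite le_powR ?(ltW a_gt0)// ltW.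
Qed.

(** For g = y/sigma the sum runs over the levels t < 2g, so [level_sum] bounds the sum of t^(p-1) by
    a multiple of (2g)^(p-1), and g^(p-1) y = y^p v. *)
Lemma level_dual_weight (v y : \bar R) (t0 : R) m : 0 < t0 ->
  (0 <= v < +oo)%E -> (0 <= y)%E -> (wpow v (1 - p / (p - 1)) < +oo)%E ->
  (\sum_(j < m | (level t0 j / 2)%:E * wpow v (1 - p / (p - 1)) < y)
     (2 * level t0 j `^ a)%:E * y <= (2 * geometric_const a * 2 `^ a)%:E * (y `^ p * v))%E.
Proof.
have p0 : 0 < p by rewrite (lt_trans _ p_gt1).
move=> t00 vb y0 /(dual_weight v vb)[w w0 [-> ->]].
have B0 := geometric_const_gt0 _ a_gt0.
case: y y0 => [y| |]//; last first.
  rewrite poweRyr ?gt_eqF// gt0_mulye ?lte_fin// gt0_muley ?leey//.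
  by rewrite lte_fin mulr_gt0 ?powR_gt0// mulr_gt0.
rewrite lee_fin => y0; rewrite poweR_EFin -!EFinM.
under eq_bigl do rewrite lte_fin.
rewrite sumEFin lee_fin.
set s := (w `^ a^-1)^-1; have s0 : 0 < s by rewrite invr_gt0 powR_gt0.
rewrite -mulr_suml -mulr_sumr.
apply: (@le_trans _ _ (2 * (geometric_const a * (2 * y / s) `^ a) * y)).
  rewrite ler_wpM2r// ler_pM2l//.
  rewrite (eq_bigl (fun j : 'I_m => level t0 j < 2 * y / s)).
    by apply: level_sum => //; rewrite divr_ge0 ?mulr_ge0// ltW.
  by move=> j; rewrite ltr_pdivlMr// -[RHS](ltr_pM2l (x:=2^-1)) ?invr_gt0//
      (mulrA _ 2) mulVf// mul1r mulrA [2^-1 * _]mulrC.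
have -> : (2 * y / s) `^ a = 2 `^ a * y `^ a * w.
  have s0' : 0 <= s^-1 by rewrite invr_ge0 ltW.
  have y2 : 0 <= 2 * y by rewrite mulr_ge0.
  rewrite (powRM _ y2 s0') (powRM _ (ler0n _ 2) y0); congr (_ * _).
  by rewrite -powR_inv1 ?(ltW s0)// -powRrM mulN1r powRN dual_weight_powR// invrK.
rewrite -(mulr_powRB1 y0 p0) -/a le_eqVlt; apply/orP; left; apply/eqP; ring.
Qed.

End pointwise.

(** * Weights and their duals almost everywhere *)

Section measurability.
Context {R : realType} {n : nat}.
Local Notation mu := (@lebesgue_measure_Rn R n).

(** Cubes are Caratheodory measurable, and [A] is a countable union of cubes by [countable_cubes]
    with A for the domain; the ratio 1/2 is an arbitrary choice in (0, 1). *)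
Lemma open_proper_measurable (A : set (Rn R n)) : open A -> ~` A !=set0 ->
  measurable A.
Proof.
move=> oA A0; have [AN0|An] := pselect (A !=set0); last first.
  suff -> : A = set0 by [].
  by apply/seteqP; split => // x Ax; case: An; exists x.
have h01 : 0 < (2^-1 : R) < 1 by apply/andP; split; lra.
have [D [FD HD]] := countable_cubes A 2^-1 oA A0 h01 AN0.
have -> : A = \bigcup_k cube (D k).1 (D k).2.
  apply/seteqP; split => [x Ax|x [k _ kx]].
    have [l Fl l0] := cubes_nonempty _ _ oA A0 h01 _ Ax.
    have [k [kl _]] := HD _ _ 2 Fl (ltr1n _ 2).
    by exists k => //; apply/kl/cube_center/ltW.
  have FDk : cubes A 2^-1 ((D k).1, (D k).2) by case: (D k) (FD k).
  exact: cubes_subset FDk _ kx.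
by apply: bigcupT_measurable => k; exact: measurable_cube.
Qed.

Lemma compact_subset_measurable (A K : set (Rn R n)) : open A -> ~` A !=set0 ->
  K `<=` A -> compact K -> measurable K.
Proof.
move=> oA [y Ay] KA cK.
have -> : K = A `\` (A `\` K).
  apply/seteqP; split => x; first by move=> Kx; split; [exact: KA|case].
  by move=> [Ax H]; apply: contrapT => Kx; apply: H.
apply: measurableD; first by apply: open_proper_measurable => //; exists y.
apply: open_proper_measurable.
  rewrite setDE; apply: openI => //; apply: closed_openC.
  by apply: compact_closed => //; exact: norm_hausdorff.
by exists y => -[].
Qed.

End measurability.

Section ae_finite.
Context {R : realType} {n : nat}.
Local Notation mu := (@lebesgue_measure_Rn R n).
Context (Omega : set (Rn R n)) (beta : R).
Context (Omega_open : open Omega) (Omega_proper : ~` Omega !=set0).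
Context (Omega_nonempty : Omega !=set0) (beta01 : 0 < beta < 1).
Local Notation F := (cubes Omega beta).
Let Omega_measurable : measurable Omega := open_proper_measurable Omega Omega_open Omega_proper.

Lemma weight_ae_lty w : weight Omega w ->
  {ae mu, forall x, Omega x -> (w x < +oo)%E}.
Proof.
move=> ww; have [mw w0 wloc] := ww.
have [D [FD HD]] := countable_cubes Omega beta Omega_open Omega_proper beta01 Omega_nonempty.
have FDk k : F ((D k).1, (D k).2) by case: (D k) (FD k).
have Dk k : {ae mu, forall x, cube (D k).1 (D k).2 x -> w x \is a fin_num}.
  have kO := cubes_subset _ _ beta01 _ _ (FDk k).
  apply: integrable_ae; first exact: measurable_cube.
  apply/integrableP; split; first exact: measurable_funS mw.
  rewrite (eq_integral w); last by move=> x; rewrite inE => /kO /w0 ?; rewrite gee0_abs.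
  by apply: wloc => //; apply/compact_cube/(cubes_gt0 _ _ _ _ (FDk k)).
have := ae_foralln Dk.
apply: filterS => x H Ox.
have [l Fl l0] := cubes_nonempty _ _ Omega_open Omega_proper beta01 _ Ox.
have [k [kl _]] := HD _ _ 2 Fl (ltr1n _ 2).
by rewrite ltey_eq (H k)//; apply/kl/cube_center/ltW.
Qed.

Context (p : R) (p_gt1 : 1 < p).
Context (v sigma : Rn R n -> \bar R).
Context (weight_v : weight Omega v) (weight_sigma : weight Omega sigma).
Context (sigmaE : forall x, sigma x = wpow (v x) (1 - p / (p - 1))).

Lemma dual_ae : {ae mu, forall x, Omega x ->
  (0 <= v x < +oo)%E /\ (wpow (v x) (1 - p / (p - 1)) < +oo)%E}.
Proof.
have := weight_ae_lty _ weight_sigma; have := weight_ae_lty _ weight_v.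
apply: filterS2 => x vx sx Ox; rewrite vx// -sigmaE sx// andbT.
by have [_ v0 _] := weight_v; rewrite v0.
Qed.

(** If sigma(Q) were 0, [sigma] would vanish almost everywhere on Q, whereas it is positive wherever
    [v] is finite. Positivity allows division by sigma(Q). *)
Lemma dual_weight_gt0 c l : F (c, l) -> (0 < mu (cube c l))%E ->
  0 < wmeasR sigma (cube c l).
Proof.
move=> Fcl V0; have [msig sig0 _] := weight_sigma.
have cO := cubes_subset _ _ beta01 _ _ Fcl.
have mc : measurable (cube c l) by exact: measurable_cube.
rewrite lt_neqAle (wmeasR_ge0 Omega)// andbT eq_sym; apply/eqP => S0.
have : wmeas sigma (cube c l) = 0%E.
  by rewrite (wmeasRE Omega beta)// ?S0//; exact: in_cube_cube.
have -> : wmeas sigma (cube c l) = (\int[mu]_(x in cube c l) `|sigma x|)%E.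
  by apply: eq_integral => x; rewrite inE => /cO /sig0 ?; rewrite gee0_abs.
move=> /ae_eq_integral_abs ae0.
have {}ae0 := ae0 mc (measurable_funS Omega_measurable cO msig).
suff /negligibleP : mu.-negligible (cube c l) by move=> /(_ mc) cl0; rewrite cl0 ltxx in V0.
suff : {ae mu, forall x, ~ cube c l x}.
  by rewrite /almost_everywhere; apply: negligibleS => x /= cx /(_ cx).
have := dual_ae; apply: filterS2 ae0 => x sx H cx.
have [vb soo] := H (cO _ cx); have [w w0 [_ sw]] := dual_weight _ p_gt1 _ vb soo.
have := sx cx; rewrite sigmaE sw /= => -[] /eqP.
by rewrite gt_eqF// invr_gt0 powR_gt0.
Qed.

Lemma measurable_powR_weight f : measurable_fun Omega f ->
  measurable_fun Omega (fun x => (`|f x| `^ p * v x)%E).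
Proof.
move=> mf; have [mv _ _] := weight_v.
apply: emeasurable_funM; last exact: mv.
apply: (@measurableT_comp _ _ _ _ _ _ (fun y => poweR y p)).
  exact: measurable_poweR.
exact: measurableT_comp.
Qed.

(** Integrate |f| <= sigma + |f|^p v. Consequently the lemmas on weights apply to |f|, whose
    averages over admissible cubes are finite. *)
Lemma Lp_weighted_weight f : Lp_weighted Omega p v f ->
  weight Omega (fun x => `|f x|%E).
Proof.
move=> [mf fp]; have [mv v0 _] := weight_v; have [ms s0 sloc] := weight_sigma.
have mfp := measurable_powR_weight _ mf.
have mabs : measurable_fun Omega (fun x => `|f x|%E).
  exact: measurableT_comp.
have fp0 x : Omega x -> (0 <= `|f x| `^ p * v x)%E.
  by move=> Ox; rewrite mule_ge0 ?poweR_ge0 ?v0.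
split => //.
move=> K KO cK; have mK := compact_subset_measurable _ _ Omega_open Omega_proper KO cK.
apply: (@le_lt_trans _ _ (\int[mu]_(x in K) (sigma x + `|f x| `^ p * v x))%E).
  apply: ae_ge0_le_integral.
  - exact: mK.
  - by move=> x _; exact: abse_ge0.
  - exact: measurable_funS Omega_measurable KO mabs.
  - by move=> x /KO Ox; rewrite adde_ge0 ?s0 ?fp0.
  - apply: emeasurable_funD; first exact: measurable_funS Omega_measurable KO ms.
    exact: measurable_funS Omega_measurable KO mfp.
  - apply: filterS dual_ae => x H /KO /H[vb soo].
    by rewrite sigmaE; apply: le_dual_weightD.
rewrite ge0_integralD.
- apply: lte_add_pinfty; first exact: sloc.
  apply: le_lt_trans fp.
  exact: ge0_subset_integral mK Omega_measurable _ mfp fp0 KO.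
- exact: mK.
- by move=> x /KO; exact: s0.
- exact: measurable_funS Omega_measurable KO ms.
- by move=> x /KO; exact: fp0.
- exact: measurable_funS Omega_measurable KO mfp.
Qed.

End ae_finite.

(** * The estimate for finitely many cubes *)

(** Starting the levels at half the smallest positive A_i lets natural exponents suffice. The index
    of A_i is the least j with A_i <= 2 t_j; minimality gives the lower bound, and for j = 0 it
    comes from the halving. *)
Lemma level_index (R : realType) (J : nat) (A : 'I_J -> R) :
  exists2 t0 : R, 0 < t0 & exists m (k : 'I_J -> 'I_m.+1), forall i, 0 < A i ->
    level t0 (k i) < A i <= 2 * level t0 (k i).
Proof.
pose t1 := \big[Num.min/1]_(i < J | 0 < A i) A i.
have t1_gt0 : 0 < t1 by rewrite /t1; elim/big_ind : _ => // x y x0 y0; rewrite lt_min x0.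
have t1A i : 0 < A i -> t1 <= A i.
  by move=> Ai; rewrite /t1 (bigD1 i)//= ge_min lexx.
pose t0 := t1 / 2; have t00 : 0 < t0 by rewrite divr_gt0.
have t01 : t0 < t1 by rewrite /t0; lra.
exists t0 => //.
pose M := \sum_(i < J) `|A i|.
have AM i : A i <= M.
  by rewrite (le_trans (ler_norm _))// /M (bigD1 i)//= lerDl sumr_ge0.
have [m _ Hm] := exists_natr_ge (M / t0).
have two_exp (j : nat) : j%:R <= 2 ^+ j :> R.
  by rewrite -natrX ler_nat ltnW// ltn_expl.
have AL i : A i <= 2 * level t0 m.
  rewrite (le_trans (AM i))//; move: Hm; rewrite ler_pdivrMr// => Hm.
  rewrite (le_trans Hm)// /level mulrC.
  apply: (@le_trans _ _ (t0 * 2 ^+ m)); first by rewrite ler_pM2l.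
  by rewrite ler_peMl ?ler1n// mulr_ge0 ?(ltW t00)// exprn_ge0.
have ex i : exists j, A i <= 2 * level t0 j by exists m.
pose k i := ex_minn (ex i).
have km i : (k i < m.+1)%N.
  by rewrite /k; case: ex_minnP => j _ /(_ m (AL i)); rewrite ltnS.
exists m, (fun i => Ordinal (km i)) => i Ai /=.
rewrite /k; case: ex_minnP => -[|j] jA jmin; rewrite jA andbT.
  by rewrite /level expr0 mulr1 (lt_le_trans t01)// t1A.
rewrite /level exprS mulrCA ltNge; apply/negP => H.
by have := jmin j H; rewrite ltnn.
Qed.

Section finite_estimate.
Context {R : realType} {n : nat}.
Local Notation mu := (@lebesgue_measure_Rn R n).
Local Notation N := n.+1.
Context (Omega : set (Rn R n)) (beta : R).
Context (Omega_open : open Omega) (Omega_proper : ~` Omega !=set0).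
Context (Omega_nonempty : Omega !=set0) (beta01 : 0 < beta < 1).
Local Notation F := (cubes Omega beta).
Context (p q : R) (p_gt1 : 1 < p) (pq : p <= q).
Context (u v sigma : Rn R n -> \bar R).
Context (weight_u : weight Omega u) (weight_v : weight Omega v).
Context (weight_sigma : weight Omega sigma).
Context (sigmaE : forall x, sigma x = wpow (v x) (1 - p / (p - 1))).
Context (D : R) (D_ge1 : 1 <= D).
Local Notation S c l := (wmeasR sigma (cube c l)).
Context (doubling_sigma : forall x l, F (x, 2 * l) -> S x (2 * l) <= D * S x l).
Context (V0 : R) (V0_gt0 : 0 < V0).
Context (S_gt0 : forall c l, F (c, l) -> 0 < S c l).
Context (K : R) (K_ge0 : 0 <= K).
Context (testing : forall (J : nat) (P : pred 'I_J) (E : 'I_J -> set (Rn R n))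
  (Q : 'I_J -> Rn R n * R) (c : Rn R n) (l : R), F (c, l) ->
  admissible_family Omega beta P E Q ->
  (forall i, P i -> cube (Q i).1 (Q i).2 `<=` cube c l) ->
  \sum_(i < J | P i) wmeasR u (E i) * density sigma V0 (Q i) `^ q
    <= K * S c l `^ (q / p)).
Let Omega_measurable : measurable Omega := open_proper_measurable Omega Omega_open Omega_proper.

Section one_function.
Context (f : Rn R n -> \bar R) (Lp_f : Lp_weighted Omega p v f).
Let phi x := `|f x|%E.
Let weight_phi : weight Omega phi :=
  Lp_weighted_weight _ _ Omega_open Omega_proper Omega_nonempty beta01 _ p_gt1 _ _
   weight_v weight_sigma sigmaE _ Lp_f.

(** The set 2g > t, with the quotient g = |f|/sigma cleared. *)
Definition superlevel (t : R) : set (Rn R n) :=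
  Omega `&` [set x | ((t / 2)%:E * sigma x < `|f x|)%E].

Lemma measurable_superlevel t : measurable (superlevel t).
Proof.
have [mphi _ _] := weight_phi; have [ms _ _] := weight_sigma.
have mts : measurable_fun Omega (fun x => ((t / 2)%:E * sigma x)%E).
  by apply: emeasurable_funM.
have := measurable_fun_lte mts mphi.
by move=> /(_ Omega_measurable [set true] I).
Qed.

(** Off the superlevel set |f| <= (t/2) sigma, so that part contributes at most t sigma(Q)/2; the
    rest must come from the superlevel set. *)
Lemma superlevel_estimate c l t : F (c, l) -> 0 < t -> t * S c l < wmeasR phi (cube c l) ->
  t * S c l <= 2 * wmeasR phi (cube c l `&` superlevel t).
Proof.
move=> Fcl t0 tS; have [ms s0 _] := weight_sigma; have [mphi phi0 _] := weight_phi.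
have mc : measurable (cube c l) by exact: measurable_cube.
have cO := cubes_subset _ _ beta01 _ _ Fcl.
have ic : in_cube Omega beta (cube c l) by exact: in_cube_cube.
have mQH : measurable (cube c l `&` superlevel t).
  by apply: measurableI => //; exact: measurable_superlevel.
have mQD : measurable (cube c l `\` superlevel t).
  by apply: measurableD => //; exact: measurable_superlevel.
have QDO : cube c l `\` superlevel t `<=` Omega by move=> x [/cO].
have iQH : in_cube Omega beta (cube c l `&` superlevel t).
  by apply: in_cubeS ic; exact: subIsetl.
have H : (wmeas phi (cube c l) <=
    wmeas phi (cube c l `&` superlevel t) + wmeas phi (cube c l `\` superlevel t))%E.
  have {1}-> : cube c l = (cube c l `&` superlevel t) `|` (cube c l `\` superlevel t).
    by rewrite setUIDK.
  by apply: wmeas_setU => //; exact: in_cube_Omega iQH.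
have H2 : (wmeas phi (cube c l `\` superlevel t) <= (t / 2)%:E * wmeas sigma (cube c l))%E.
  apply: (@le_trans _ _ ((t / 2)%:E * wmeas sigma (cube c l `\` superlevel t))%E); last first.
    by rewrite lee_pmul2l ?lte_fin ?divr_gt0//; apply: (wmeas_le Omega) => //; exact: subDsetl.
  rewrite /wmeas -ge0_integralZl_EFin//.
  - apply: ge0_le_integral.
    + exact: mQD.
    + by move=> x _; exact: abse_ge0.
    + exact: (measurable_funS Omega_measurable QDO mphi).
    + apply: emeasurable_funM; first exact: measurable_cst.
      exact: measurable_funS Omega_measurable QDO ms.
    + move=> x [/cO Ox nH]; rewrite leNgt; apply/negP => H'; apply: nH; split => //.
  - by move=> x /QDO; exact: s0.
  - exact: measurable_funS ms.
  - by rewrite divr_ge0// ltW.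
have : wmeasR phi (cube c l) <= wmeasR phi (cube c l `&` superlevel t) + t / 2 * S c l.
  rewrite -lee_fin EFinD EFinM -!(wmeasRE Omega beta)//.
  by rewrite (le_trans H)// leeD2l.
lra.
Qed.

(** Write t^p = t^(p-1) t and apply [superlevel_estimate]. Cubes of one level are disjoint, so their
    integrals add up to at most one integral over the superlevel set; [level_dual_weight] then sums
    the levels under the integral sign. *)
Lemma levels_estimate (t0 : R) (J m : nat) (Q : 'I_J -> Rn R n * R) (A : 'I_m -> {set 'I_J}) :
  0 < t0 -> (forall j s, s \in A j -> F (Q s) /\
    level t0 j * wmeasR sigma (cube (Q s).1 (Q s).2) < wmeasR phi (cube (Q s).1 (Q s).2)) ->
  (forall j i s, i \in A j -> s \in A j -> i != s ->
      cube (Q i).1 (Q i).2 `&` cube (Q s).1 (Q s).2 = set0) ->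
  ((\sum_(j < m) \sum_(s in A j) level t0 j `^ p * wmeasR sigma (cube (Q s).1 (Q s).2))%:E
   <= (2 * geometric_const (p - 1) * 2 `^ (p - 1))%:E *
      \int[mu]_(x in Omega) (`|f x| `^ p * v x))%E.
Proof.
move=> t00 HA Adisj; have [ms s0 _] := weight_sigma; have [mphi phi0 _] := weight_phi.
have a0 : 0 < p - 1 by rewrite subr_gt0.
have p0 : 0 < p by rewrite (lt_trans _ p_gt1).
have L0 j : 0 < level t0 j by exact: level_gt0.
pose g (j : 'I_m) (x : Rn R n) : \bar R :=
  ((2 * level t0 j `^ (p - 1))%:E * (phi \_ (superlevel (level t0 j))) x)%E.
have mphiH (j : 'I_m) : measurable_fun Omega (phi \_ (superlevel (level t0 j))).
  apply/(measurable_restrict _ _ _) => //; first exact: measurable_superlevel.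
  by apply: measurable_funS mphi => // x [].
have mg j : measurable_fun Omega (g j) by apply: emeasurable_funM.
have g0 j x : Omega x -> (0 <= g j x)%E.
  move=> Ox; rewrite mule_ge0// ?lee_fin ?mulr_ge0 ?powR_ge0//.
  by apply: erestrict_ge0 => y _; exact: abse_ge0.
have step j : ((\sum_(s in A j) level t0 j `^ p * wmeasR sigma (cube (Q s).1 (Q s).2))%:E
    <= \int[mu]_(x in Omega) g j x)%E.
  have mH := measurable_superlevel (level t0 j).
  rewrite /g ge0_integralZl_EFin//; last 2 first.
    by move=> x _; apply: erestrict_ge0 => y _; exact: abse_ge0.
    by rewrite mulr_ge0 ?powR_ge0.
  rewrite -integral_mkcondr (setIidr (_ : superlevel _ `<=` Omega)); last by move=> x [].
  apply: (@le_trans _ _ ((2 * level t0 j `^ (p - 1))%:E *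
    (\sum_(s in A j) wmeasR phi (cube (Q s).1 (Q s).2 `&` superlevel (level t0 j)))%:E)%E).
    rewrite -EFinM lee_fin mulr_sumr; apply: ler_sum => s sA.
    have [FQ H] := HA j s sA.
    rewrite -(mulr_powRB1 (ltW (L0 j)) p0) [level t0 j * _]mulrC -mulrA.
    rewrite [2 * _]mulrC -[leRHS]mulrA ler_wpM2l ?powR_ge0//.
    by apply: superlevel_estimate => //; case: (Q s) FQ.
  rewrite lee_wpmul2l ?lee_fin ?mulr_ge0 ?powR_ge0// -sumEFin.
  rewrite (eq_bigr (fun s => wmeas phi (cube (Q s).1 (Q s).2 `&` superlevel (level t0 j)))).
    apply: (wmeas_disj Omega) => //.
    - by move=> s sA; split; [apply: measurableI => //; exact: measurable_cube|exact: subIsetr].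
    - move=> i s iA sA ij; apply/seteqP; split => // x [[Qi _] [Qs _]].
      by rewrite -(Adisj j i s iA sA ij).
    - by move=> x [].
  move=> s sA; have [FQ _] := HA j s sA; rewrite (wmeasRE Omega beta)//.
    by apply: measurableI => //; exact: measurable_cube.
  by exists (Q s) => //; exact: subIsetl.
rewrite -sumEFin; apply: (@le_trans _ _ (\sum_(j < m) \int[mu]_(x in Omega) g j x)%E).
  by apply: lee_sum => j _; exact: step.
have -> : (\sum_(j < m) \int[mu]_(x in Omega) g j x =
    \int[mu]_(x in Omega) \sum_(j < m) g j x)%E by rewrite ge0_integral_sum.
have B0 : 0 <= 2 * geometric_const (p - 1) * 2 `^ (p - 1).
  have G0 := ltW (geometric_const_gt0 _ a0).
  by rewrite mulr_ge0 ?powR_ge0// mulr_ge0.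
pose h x := (`|f x| `^ p * v x)%E.
have mh : measurable_fun Omega h by apply: measurable_powR_weight => //; case: Lp_f.
have h0 x : Omega x -> (0 <= h x)%E.
  by move=> Ox; have [_ v0 _] := weight_v; rewrite mule_ge0 ?poweR_ge0 ?v0.
rewrite -(ge0_integralZl_EFin mu Omega_measurable h0 mh B0).
apply: ae_ge0_le_integral.
- exact: Omega_measurable.
- by move=> x Ox; apply: sume_ge0 => j _; exact: g0.
- by apply: emeasurable_sum.
- by move=> x Ox; rewrite mule_ge0 ?lee_fin ?h0.
- exact: emeasurable_funM.
have := dual_ae _ _ Omega_open Omega_proper Omega_nonempty beta01 _ _ _ weight_v
  weight_sigma sigmaE.
apply: filterS => x H Ox; have [vb soo] := H Ox.
rewrite (le_trans _ (level_dual_weight _ p_gt1 _ _ _ m t00 vb (abse_ge0 (f x)) soo))//.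
rewrite [leRHS]big_mkcond/=; apply: lee_sum => j _; rewrite /g /patch.
case: ifPn => [|_]; last by rewrite mule0; case: ifP => // _; rewrite mule_ge0 ?lee_fin ?mulr_ge0 ?powR_ge0.
by rewrite inE => -[_ /=]; rewrite sigmaE => ->.
Qed.

End one_function.
Lemma finite_estimate : exists2 C, 0 <= C &
  forall f, Lp_weighted Omega p v f ->
  forall (J : nat) (E : 'I_J -> set (Rn R n)) (Q : 'I_J -> Rn R n * R),
  admissible_family Omega beta xpredT E Q ->
  \sum_(i < J) wmeasR u (E i) *
     density (fun x => `|f x|%E) V0 (Q i) `^ q
  <= C * fine (\int[mu]_(x in Omega) (`|f x| `^ p * v x))%E `^ (q / p).
Proof.
have p0 : 0 < p by rewrite (lt_trans _ p_gt1).
have q0 : 0 < q by rewrite (lt_le_trans p0).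
have rr0 : 0 < q / p by rewrite divr_gt0.
have rr1 : 1 <= q / p by rewrite ler_pdivlMr// mul1r.
have [C1 C10 sel] := selection_estimate _ _ Omega_proper Omega_measurable beta01 _ _
  weight_sigma weight_u _ D_ge1 doubling_sigma S_gt0 _ V0_gt0 _ _ q0 rr0 _ K_ge0 testing.
pose B := 2 * geometric_const (p - 1) * 2 `^ (p - 1).
have B0 : 0 <= B.
  have G0 := ltW (geometric_const_gt0 (p - 1) (ltac:(by rewrite subr_gt0) : 0 < p - 1)).
  by rewrite mulr_ge0 ?powR_ge0// mulr_ge0.
exists (C1 * 2 `^ q * B `^ (q / p)); first by rewrite !mulr_ge0 ?powR_ge0.
move=> f Lp_f J E Q fam; have [HE Edisj] := fam.
have weight_phi := Lp_weighted_weight _ _ Omega_open Omega_proper Omega_nonempty beta01 _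
  p_gt1 _ _ weight_v weight_sigma sigmaE _ Lp_f.
set phi := fun x => `|f x|%E in weight_phi *.
have FQ i : F ((Q i).1, (Q i).2) by have [] := HE i isT; case: (Q i).
pose s i := wmeasR sigma (cube (Q i).1 (Q i).2).
have s_gt0 i : 0 < s i by exact: S_gt0.
pose A i := wmeasR phi (cube (Q i).1 (Q i).2) / s i.
have cO i := cubes_subset _ _ beta01 _ _ (FQ i).
have A_ge0 i : 0 <= A i by rewrite divr_ge0 ?(ltW (s_gt0 _))// (wmeasR_ge0 Omega).
have dens_ge0 i : 0 <= density sigma V0 (Q i).
  rewrite /density divr_ge0//; first exact/ltW/s_gt0.
  by rewrite mulr_ge0 ?(ltW V0_gt0)// exprn_ge0// ltW// (cubes_gt0 _ _ _ _ (FQ i)).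
have U_ge0 i : 0 <= wmeasR u (E i).
  apply: (wmeasR_ge0 Omega) => //; have [_ _ EQ] := HE i isT.
  exact: subset_trans EQ (cO i).
pose om i := wmeasR u (E i) * density sigma V0 (Q i) `^ q.
have om_ge0 i : 0 <= om i by rewrite mulr_ge0 ?powR_ge0.
have densE i : wmeasR u (E i) * density phi V0 (Q i) `^ q = om i * A i `^ q.
  rewrite /om -mulrA -powRM//; congr (_ * _ `^ _).
  by rewrite /density /A -/(s i) [RHS]mulrC [RHS]mulrA divfK ?gt_eqF// s_gt0.
under eq_bigr do rewrite densE.
have [t0 t00 [m [k Hk]]] := level_index _ _ A.
have L0 j : 0 < level t0 j by exact: level_gt0.
have selj (j : 'I_m.+1) : exists G : {set 'I_J}, [/\ forall i, i \in G -> (0 < A i) && (k i == j),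
    forall i s, i \in G -> s \in G -> i != s ->
      cube (Q i).1 (Q i).2 `&` cube (Q s).1 (Q s).2 = set0 &
    \sum_(i < J | (0 < A i) && (k i == j)) om i <= C1 * \sum_(i in G) s i `^ (q / p)].
  by apply: sel; split => [i _|i i' _ _]; [exact: HE|exact: Edisj].
pose G j := projT1 (cid (selj j)).
have HG j := projT2 (cid (selj j)).
have -> : C1 * 2 `^ q * B `^ (q / p) *
    fine (\int[mu]_(x in Omega) (`|f x| `^ p * v x))%E `^ (q / p) =
  2 `^ q * (C1 * (B * fine (\int[mu]_(x in Omega) (`|f x| `^ p * v x))%E) `^ (q / p)).
  rewrite powRM//; first by ring.
  apply: fine_ge0; apply: integral_ge0 => x Ox.
  by have [_ v0 _] := weight_v; rewrite mule_ge0 ?poweR_ge0 ?v0.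
(* A_i <= 2t on the group of level t, whence 2^q; indices with A_i = 0 belong to no group and
   contribute nothing. *)
apply: (@le_trans _ _ (2 `^ q * \sum_(j < m.+1) level t0 j `^ q *
    \sum_(i < J | (0 < A i) && (k i == j)) om i)).
  rewrite (bigID (fun i => 0 < A i))/= [X in _ + X]big1 ?addr0; last first.
    move=> i; rewrite lt_neqAle A_ge0 andbT negbK => /eqP <-.
    by rewrite powR0 ?mulr0// gt_eqF.
  rewrite (partition_big k xpredT)//= mulr_sumr; apply: ler_sum => j _.
  rewrite mulrA mulr_sumr; apply: ler_sum => i /andP[Ai /eqP kij].
  have /andP[_ Al] := Hk i Ai; rewrite kij in Al.
  by rewrite mulrC ler_wpM2r// -powRM ?(ltW (L0 _))// le_powR// ltW.
rewrite ler_wpM2l ?powR_ge0//.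
(* As t^q = (t^p)^(q/p), the level moves inside the power, and [sum_powR_le] then acts on all pairs
   of a level and a cube at once. *)
apply: (@le_trans _ _ (C1 * \sum_(j < m.+1) \sum_(i in G j)
    (level t0 j `^ p * s i) `^ (q / p))).
  rewrite mulr_sumr; apply: ler_sum => j _; have [_ _ H] := HG j.
  rewrite (le_trans (ler_wpM2l (powR_ge0 _ _) H))// mulrCA ler_wpM2l//.
  rewrite mulr_sumr; apply: ler_sum => i _.
  rewrite powRM ?powR_ge0 ?(ltW (s_gt0 _))// -powRrM.
  by have -> : p * (q / p) = q by rewrite mulrCA divff ?mulr1 ?gt_eqF.
rewrite ler_wpM2l// pair_big_dep/=.
have pos_term (j : 'I_m.+1) i : 0 <= level t0 j `^ p * s i.
  by rewrite mulr_ge0 ?powR_ge0// ltW.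
rewrite (le_trans (sum_powR_le _ _ _ (fun ji : 'I_m.+1 * 'I_J =>
  level t0 ji.1 `^ p * s ji.2) _ rr1 _))//.
apply: le_powR; first exact: ltW.
  by apply: sumr_ge0 => ji _.
rewrite -(pair_big_dep xpredT (fun j i => i \in G j) (fun j i => level t0 j `^ p * s i))/=.
have Ifin : (\int[mu]_(x in Omega) (`|f x| `^ p * v x))%E \is a fin_num.
  rewrite ge0_fin_numE; first by case: Lp_f.
  apply: integral_ge0 => x Ox.
  by have [_ v0 _] := weight_v; rewrite mule_ge0 ?poweR_ge0 ?v0.
rewrite -lee_fin EFinM fineK//.
apply: (levels_estimate _ Lp_f) => // [j i iG|j i i' iG i'G ii'].
  have [Gk _ _] := HG j; have /andP[Ai /eqP kij] := Gk _ iG.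
  split; first by have [] := HE i isT.
  by have /andP[+ _] := Hk i Ai; rewrite kij /A ltr_pdivlMr.
by have [_ Gd _] := HG j; exact: Gd.
Qed.

End finite_estimate.

(** * The maximal function as a countable supremum *)

Section ereal_powers.
Context {R : realType}.
Local Open Scope ereal_scope.
Implicit Types x y w : \bar R.

Lemma le_poweR x y (r : R) : (0 <= r)%R -> 0 <= x -> x <= y -> x `^ r <= y `^ r.
Proof.
move=> r0 x0 xy; apply: gt0_ler_poweR => //; rewrite in_itv/= leey andbT//.
exact: le_trans xy.
Qed.

Lemma poweRK x (r : R) : (r != 0)%R -> 0 <= x -> (x `^ r) `^ r^-1 = x.
Proof. by move=> r0 x0; rewrite -poweRrM divff// poweRe1. Qed.

Lemma poweRVK x (r : R) : (r != 0)%R -> 0 <= x -> (x `^ r^-1) `^ r = x.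
Proof. by move=> r0 x0; rewrite -poweRrM mulVf// poweRe1. Qed.

(** For 0 < w < +oo divide by w and take q-th roots. For w = +oo either some a_k is nonzero and both
    sides are infinite, or both vanish by the convention that 0 times [+oo] is 0. *)
Lemma ereal_sup_poweRM (q : R) w (a : nat -> \bar R) : (0 < q)%R -> 0 <= w ->
  (forall k, 0 <= a k) ->
  ereal_sup (range (fun k => a k `^ q * w)) = ereal_sup (range a) `^ q * w.
Proof.
move=> q0 w0 a0; apply/eqP; rewrite eq_le; apply/andP; split.
  apply: ge_ereal_sup => _ [k _ <-]; rewrite lee_wpmul2r//.
  by apply: le_poweR => //; [exact: ltW|apply: ereal_sup_ubound; exists k].
set B := ereal_sup (range (fun k => a k `^ q * w)).
have aB k : a k `^ q * w <= B by apply: ereal_sup_ubound; exists k.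
have B0 : 0 <= B by apply: le_trans (aB 0%N); rewrite mule_ge0 ?poweR_ge0.
case: w w0 @B aB B0 => [w| |]//; last first.
  move=> _ B aB B0; have [|all0] := pselect (exists k, a k != 0).
    move=> [k ak0]; have := aB k; rewrite gt0_muley ?leye_eq; last first.
      by rewrite poweR_gt0// lt_def ak0 a0.
    by move=> /eqP ->; rewrite leey.
  have -> : ereal_sup (range a) = 0.
    apply/eqP; rewrite eq_le; apply/andP; split.
      apply: ge_ereal_sup => _ [k _ <-]; rewrite leNgt; apply/negP => ak.
      by apply: all0; exists k; rewrite gt_eqF.
    by apply: (le_trans (a0 0%N)); apply: ereal_sup_ubound; exists 0%N.
  by rewrite poweR0r ?gt_eqF// mul0e.
rewrite lee_fin le_eqVlt => /orP[/eqP <- B aB B0|w0 B aB B0]; first by rewrite mule0.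
rewrite -lee_pdivlMr//; set Y := B * _.
have Y0 : 0 <= Y by rewrite mule_ge0// lee_fin invr_ge0 ltW.
have s0 : 0 <= ereal_sup (range a).
  by apply: (le_trans (a0 0%N)); apply: ereal_sup_ubound; exists 0%N.
rewrite -[leRHS](@poweRVK _ q) ?gt_eqF//; apply: le_poweR; [exact: ltW|by []|].
apply: ge_ereal_sup => _ [k _ <-].
rewrite -[leLHS](@poweRK _ q) ?gt_eqF//; apply: le_poweR.
- by rewrite invr_ge0 ltW.
- exact: poweR_ge0.
- by rewrite /Y lee_pdivlMr.
Qed.

End ereal_powers.

Section maximal_function.
Context {R : realType} {n : nat}.
Local Notation mu := (@lebesgue_measure_Rn R n).
Local Notation N := n.+1.
Context (Omega : set (Rn R n)) (beta : R).
Context (Omega_open : open Omega) (Omega_proper : ~` Omega !=set0).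
Context (Omega_nonempty : Omega !=set0) (beta01 : 0 < beta < 1).
Local Notation F := (cubes Omega beta).
Let V0 : R := fine (mu (cube 0%R 1%R)).
Context (V0_gt0 : 0 < V0).
Let Omega_measurable : measurable Omega := open_proper_measurable Omega Omega_open Omega_proper.

Lemma lebesgue_measure_cubeE (c : Rn R n) l : 0 < l -> mu (cube c l) = (l ^+ N * V0)%:E.
Proof.
move=> l0; rewrite lebesgue_measure_cube// EFinM; congr (_ * _)%E.
by rewrite /V0 fineK// ge0_fin_numE ?measure_ge0// lebesgue_measure_cube_lty.
Qed.

Context (f : Rn R n -> \bar R) (weight_f : weight Omega (fun x => `|f x|%E)).
Local Notation phi := (fun x => `|f x|%E).

Lemma average_density c l : F (c, l) ->
  average f (cube c l) = (density phi V0 (c, l))%:E.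
Proof.
move=> Fcl; have l0 := cubes_gt0 _ _ _ _ Fcl.
rewrite /average lebesgue_measure_cubeE// inver gt_eqF ?mulr_gt0 ?exprn_gt0//.
rewrite -/(wmeas phi (cube c l)) (wmeasRE Omega beta)//; last 2 first.
- exact: measurable_cube.
- exact: in_cube_cube.
by rewrite -EFinM /density mulrC.
Qed.

Lemma density_ge0 c l : F (c, l) -> 0 <= density phi V0 (c, l).
Proof.
move=> Fcl; have l0 := cubes_gt0 _ _ _ _ Fcl.
rewrite /density divr_ge0 ?mulr_ge0 ?exprn_ge0 ?(ltW l0) ?(ltW V0_gt0)//.
by apply: (wmeasR_ge0 Omega) => //; exact: cubes_subset Fcl.
Qed.

Context (D : nat -> Rn R n * R) (FD : forall k, F (D k)).
Context (HD : forall c l rho, F (c, l) -> 1 < rho ->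
    exists k, cube c l `<=` cube (D k).1 (D k).2 /\ (D k).2 <= rho * l).

Let a k : R := density phi V0 (D k).
Let Q k : set (Rn R n) := cube (D k).1 (D k).2.
Let FD' k : F ((D k).1, (D k).2). Proof. by case: (D k) (FD k). Qed.

Let a_ge0 k : 0 <= a k.
Proof. by rewrite /a; case: (D k) (FD k) => c l; exact: density_ge0. Qed.

Fixpoint max_upto (J : nat) (x : Rn R n) : \bar R :=
  if J is k.+1 then maxe (max_upto k x) (a k * \1_(Q k) x)%:E else 0%E.

Lemma max_upto_ge0 J x : (0 <= max_upto J x)%E.
Proof.
by elim: J => [|J IH] //=; rewrite le_max IH.
Qed.

Lemma max_uptoS J x : max_upto J.+1 x = maxe (max_upto J x) (a J * \1_(Q J) x)%:E.
Proof. by []. Qed.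

Lemma max_upto_homo x : {homo max_upto ^~ x : m k / (m <= k)%N >-> (m <= k)%E}.
Proof.
apply: homo_leq => //; first by move=> ? ? ?; exact: le_trans.
by move=> J; rewrite max_uptoS le_max lexx.
Qed.

Lemma measurable_max_upto J : measurable_fun Omega (max_upto J).
Proof.
elim: J => [|J IH].
  exact: measurable_cst.
rewrite (_ : max_upto J.+1 = fun x => maxe (max_upto J x) (a J * \1_(Q J) x)%:E).
  apply: measurable_maxe => //; apply/measurable_EFinP.
  apply: measurable_funM => //; apply: measurable_indic; exact: measurable_cube.
by apply/funext => x; exact: max_uptoS.
Qed.

Lemma max_uptoP J x : max_upto J x = 0%E \/
  exists2 k, (k < J)%N & Q k x /\ max_upto J x = (a k)%:E.
Proof.
elim: J => [|J IH]; first by left.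
rewrite max_uptoS; have [_|_] := leP (max_upto J x) (a J * \1_(Q J) x)%:E.
  rewrite indicE; have [QJ|nQJ] := boolP (x \in Q J); last by left; rewrite mulr0.
  by right; exists J => //; rewrite mulr1; split => //; rewrite inE in QJ.
by case: IH => [|[k kJ H]]; [left|right; exists k => //; exact: ltnW].
Qed.

(* A cube Q(c, l) lies in a cube of the countable family whose volume is at
   most rho^N times larger, for any rho > 1. *)
Lemma maximal_sup x : Omega x ->
  maximal Omega beta f x = ereal_sup (range (max_upto ^~ x)).
Proof.
move=> Ox; apply/eqP; rewrite eq_le; apply/andP; split; last first.
  apply: ge_ereal_sup => _ [J _ <-]; case: (max_uptoP J x) => [->|].
    have [l Fl l0] := cubes_nonempty _ _ Omega_open Omega_proper beta01 _ Ox.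
    apply: le_ereal_sup_tmp; exists (average f (cube x l)).
      by exists (x, l) => //; split => //; exact/cube_center/ltW.
    by rewrite average_density// lee_fin density_ge0.
  move=> [k _ [Qx ->]]; apply: ereal_sup_ubound; exists (D k) => //.
  by rewrite average_density.
set y := ereal_sup _.
have aky k : Q k x -> ((a k)%:E <= y)%E.
  move=> Qx; apply: (@le_trans _ _ (max_upto k.+1 x)).
    by rewrite max_uptoS indicE mem_set// mulr1 le_max lexx orbT.
  by apply: ereal_sup_ubound; exists k.+1.
apply: ge_ereal_sup => _ [[c l] [Fcl cx] <-]; rewrite average_density//.
have y0 : (0 <= y)%E.
  by apply: (le_trans (max_upto_ge0 0 x)); apply: ereal_sup_ubound; exists 0%N.
move: y y0 aky => [y| |]// y0 aky; last by rewrite leey.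
rewrite lee_fin in y0; rewrite lee_fin leNgt; apply/negP => ylt.
set d := density phi V0 (c, l) in ylt.
have d0 : 0 < d by apply: le_lt_trans ylt.
have l0 := cubes_gt0 _ _ _ _ Fcl.
(* For y > 0, the N-th root of the midpoint between 1 and d/y. *)
have [rho rho1 rhoy] : exists2 rho : R, 1 < rho & rho ^+ N * y < d.
  have [y00|yn0] := eqVneq y 0; first by exists 2; rewrite ?ltr1n// y00 mulr0.
  have yp : 0 < y by rewrite lt_def yn0.
  pose z := (d / y + 1) / 2.
  have z1 : 1 < z.
    have : 1 < d / y by rewrite ltr_pdivlMr// mul1r.
    rewrite /z; lra.
  exists (z `^ (N%:R)^-1).
    suff : (1 : R) `^ N%:R^-1 < z `^ N%:R^-1 by rewrite powR1.
    by apply: gt0_ltr_powR; rewrite ?nnegrE ?invr_gt0// ltW// (lt_trans _ z1).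
  rewrite -powR_mulrn ?powR_ge0// -powRrM mulVf ?pnatr_eq0// powRr1; last first.
    by rewrite ltW// (lt_trans _ z1).
  rewrite /z mulrAC mulrDl divfK// mul1r; lra.
have [k [ck Dk]] := HD _ _ _ Fcl rho1.
have := aky k (ck _ cx); rewrite lee_fin => aky'.
have Dk0 := cubes_gt0 _ _ _ _ (FD' k).
have : d <= rho ^+ N * a k.
  rewrite /d /a /density /= ler_pdivrMr ?mulr_gt0 ?exprn_gt0//.
  have ringE (A W VD VC : R) : A * (W / VD) * VC = W * (A * VC) / VD by ring.
  rewrite ringE.
  rewrite ler_pdivlMr ?mulr_gt0 ?exprn_gt0//.
  have Sle : wmeasR phi (cube c l) <= wmeasR phi (Q k).
    apply: (wmeasR_le Omega beta) => //; try exact: measurable_cube.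
    exact: in_cube_cube.
  have Vle : (D k).2 ^+ N * V0 <= rho ^+ N * (l ^+ N * V0).
    rewrite mulrA ler_pM2r// -exprMn lerXn2r// ?nnegrE ?(ltW Dk0)//.
    by rewrite mulr_ge0 ?(ltW l0)// ltW// (lt_trans _ rho1).
  have S0 : 0 <= wmeasR phi (cube c l).
    by apply: (wmeasR_ge0 Omega) => //; exact: cubes_subset Fcl.
  have VV : 0 <= (D k).2 ^+ N * V0 by rewrite mulr_ge0 ?exprn_ge0 ?(ltW Dk0) ?(ltW V0_gt0).
  exact: ler_pM.
rewrite leNgt => /negP; apply; apply: le_lt_trans rhoy.
by rewrite ler_pM2l// exprn_gt0// (lt_trans _ rho1).
Qed.

Lemma max_upto_cvg x : Omega x ->
  max_upto J x @[J --> \oo] --> maximal Omega beta f x.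
Proof.
by move=> Ox; rewrite maximal_sup//; exact: ereal_nondecreasing_cvgn (max_upto_homo x).
Qed.

Lemma measurable_maximal : measurable_fun Omega (maximal Omega beta f).
Proof.
exact: (emeasurable_fun_cvg max_upto _ measurable_max_upto max_upto_cvg).
Qed.

Context (q : R) (q_gt0 : 0 < q).
Context (u : Rn R n -> \bar R) (weight_u : weight Omega u).

Lemma measurable_poweRM (g : Rn R n -> \bar R) : measurable_fun Omega g ->
  measurable_fun Omega (fun x => g x `^ q * u x)%E.
Proof.
move=> mg; have [mu' _ _] := weight_u; apply: emeasurable_funM => //.
apply: (@measurableT_comp _ _ _ _ _ _ (fun y => poweR y q)) => //.
exact: measurable_poweR.
Qed.

Lemma integral_maximal_le (B : \bar R) :
  (forall J, \int[mu]_(x in Omega) (max_upto J x `^ q * u x) <= B)%E ->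
  (\int[mu]_(x in Omega) (maximal Omega beta f x `^ q * u x) <= B)%E.
Proof.
move=> HB; have [_ u0 _] := weight_u.
pose g J x := (max_upto J x `^ q * u x)%E.
have mg J : measurable_fun Omega (g J) by exact/measurable_poweRM/measurable_max_upto.
have g0 J x : Omega x -> (0 <= g J x)%E by move=> Ox; rewrite mule_ge0 ?poweR_ge0 ?u0.
have gh x : Omega x -> {homo g ^~ x : m k / (m <= k)%N >-> (m <= k)%E}.
  move=> Ox m k mk; rewrite /g lee_wpmul2r ?u0//.
  by apply: le_poweR; [exact: ltW|exact: max_upto_ge0|exact: max_upto_homo].
have := cvg_monotone_convergence (mu := mu) Omega_measurable mg g0 gh.
have -> : (\int[mu]_(x in Omega) (fun x0 => limn (g ^~ x0)) x =
    \int[mu]_(x in Omega) (maximal Omega beta f x `^ q * u x))%E.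
  apply: eq_integral => x; rewrite inE => Ox.
  rewrite maximal_sup// -ereal_sup_poweRM ?u0//; last by move=> k; exact: max_upto_ge0.
  by apply/cvg_lim => //; apply: ereal_nondecreasing_cvgn; exact: gh.
move=> gcvg; rewrite -(cvg_lim _ gcvg)//; apply: lime_le.
  by apply/cvg_ex; eexists; exact: gcvg.
by apply: nearW => J; exact: HB.
Qed.

(** Where the maximum is nonzero, it is some a_k with x in Q_k. [seqDU] assigns x to the first k
    with x in Q_k and maximum at most a_k, and that inequality is all the upper bound uses. *)
Lemma max_upto_family J : exists E : 'I_J -> set (Rn R n),
  admissible_family Omega beta xpredT E (fun k : 'I_J => D k) /\
  (\int[mu]_(x in Omega) (max_upto J x `^ q * u x) <=
    (\sum_(k < J) wmeasR u (E k) * a k `^ q)%:E)%E.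
Proof.
have [mu' u0 _] := weight_u.
pose G k := Q k `&` (Omega `&` [set x | (max_upto J x <= (a k)%:E)%E]).
have mG k : measurable (G k).
  apply: measurableI; first exact: measurable_cube.
  by apply: emeasurable_fun_infty_c => //; exact: measurable_max_upto.
pose E (k : 'I_J) := seqDU G k.
have EQ (k : 'I_J) : E k `<=` Q k by move=> x [[]].
have EO (k : 'I_J) : E k `<=` Omega by move=> x [[_ []]].
have mE (k : 'I_J) : measurable (E k) by exact: seqDU_measurable.
have Edisj (i j : 'I_J) : i != j -> E i `&` E j = set0.
  move=> ij; apply/seteqP; split => // x Hx.
  have /trivIsetP := trivIset_seqDU G.
  by move=> /(_ i j I I ij); rewrite -subset0; apply.
exists E; split; first by split => [i _|i j _ _]; [split|exact: Edisj].
pose g (k : 'I_J) x := ((a k `^ q)%:E * (u \_ (E k)) x)%E.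
have muE (k : 'I_J) : measurable_fun Omega (u \_ (E k)).
  apply/(measurable_restrict _ _ _) => //.
  by apply: measurable_funS mu' => // x [].
have u0E (k : 'I_J) x : Omega x -> (0 <= (u \_ (E k)) x)%E.
  by move=> _; apply: erestrict_ge0 => y /EO; exact: u0.
have g0 k x : Omega x -> (0 <= g k x)%E.
  by move=> Ox; rewrite mule_ge0 ?u0E// lee_fin powR_ge0.
have mg k : measurable_fun Omega (g k) by exact: emeasurable_funM.
have -> : (\sum_(k < J) wmeasR u (E k) * a k `^ q)%:E =
    (\int[mu]_(x in Omega) \sum_(k < J) g k x)%E.
  rewrite ge0_integral_sum// -sumEFin; apply: eq_bigr => k _.
  rewrite /g ge0_integralZl_EFin ?powR_ge0//; last by move=> x; exact: u0E.
  rewrite -integral_mkcondr (setIidr (EO k)).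
  rewrite EFinM -(wmeasRE Omega beta)//; first by rewrite muleC.
  by exists (D k) => //; exact: EQ.
apply: ge0_le_integral.
- exact: Omega_measurable.
- by move=> x Ox; rewrite mule_ge0 ?poweR_ge0 ?u0.
- exact/measurable_poweRM/measurable_max_upto.
- exact: emeasurable_sum.
move=> x Ox; have gsum0 : (0 <= \sum_(k < J) g k x)%E by apply: sume_ge0 => k _; exact: g0.
case: (max_uptoP J x) => [->|[k kJ [Qx mk]]].
  by rewrite poweR0r ?gt_eqF// mul0e.
have [i Ei] : exists i : 'I_J, E i x.
  have : (\big[setU/set0]_(i < J) G i) x.
    rewrite -bigcup_mkord; exists k => //; split => //; split => //=.
    by rewrite mk.
  by rewrite bigsetU_seqDU -bigcup_mkord => -[i /= iJ Ei]; exists (Ordinal iJ).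
rewrite (bigD1 i)//= -[leLHS]adde0; apply: leeD; last by apply: sume_ge0 => j _; exact: g0.
rewrite /g /patch mem_set// lee_wpmul2r ?u0// -poweR_EFin.
apply: le_poweR; [exact: ltW|exact: max_upto_ge0|].
by case: Ei => -[_ []].
Qed.

End maximal_function.

Lemma integral_lebesgue_Rn0 (R : realType) (n : nat) (A : set (Rn R n))
    (g : Rn R n -> \bar R) : lebesgue_measure_Rn (cube (0%R : Rn R n) 1%R) = 0%E ->
  (\int[lebesgue_measure_Rn]_(x in A) g x = 0)%E.
Proof.
move=> V0; rewrite (eq_measure_integral mzero) ?integral_measure_zero//.
by move=> B mB _; rewrite [LHS](lebesgue_measure_Rn_eq0 V0).
Qed.

(** * The testing condition *)

Section testing.
Context {R : realType} {n : nat}.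
Local Notation mu := (@lebesgue_measure_Rn R n).
Local Notation N := n.+1.
Context (Omega : set (Rn R n)) (beta : R).
Context (Omega_open : open Omega) (Omega_proper : ~` Omega !=set0).
Context (Omega_nonempty : Omega !=set0) (beta01 : 0 < beta < 1).
Local Notation F := (cubes Omega beta).
Let V0 : R := fine (mu (cube 0%R 1%R)).
Let Omega_measurable : measurable Omega := open_proper_measurable Omega Omega_open Omega_proper.
Context (sigma : Rn R n -> \bar R) (weight_sigma : weight Omega sigma).
Context (c : Rn R n) (l : R) (Fcl : F (c, l)).

Definition cutoff (x : Rn R n) : \bar R := (sigma x * (\1_(cube c l) x)%:E)%E.

Lemma cutoff_in x : cube c l x -> cutoff x = sigma x.
Proof. by move=> cx; rewrite /cutoff indicE mem_set// mule1. Qed.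

Lemma cutoff_ge0 x : Omega x -> (0 <= cutoff x)%E.
Proof.
by move=> Ox; have [_ s0 _] := weight_sigma; rewrite mule_ge0 ?s0// lee_fin.
Qed.

Lemma measurable_cutoff : measurable_fun Omega cutoff.
Proof.
have [ms _ _] := weight_sigma; apply: emeasurable_funM => //.
apply/measurable_EFinP; apply: measurable_indic; exact: measurable_cube.
Qed.

Lemma weight_cutoff : weight Omega (fun x => `|cutoff x|%E).
Proof.
have [ms s0 sloc] := weight_sigma; split; first exact: measurableT_comp measurable_cutoff.
  by move=> x _; exact: abse_ge0.
move=> A AO cA; have mA := compact_subset_measurable _ _ Omega_open Omega_proper AO cA.
apply: le_lt_trans (sloc A AO cA); apply: ge0_le_integral.
- exact: mA.
- by move=> x _; exact: abse_ge0.
- apply: measurable_funS Omega_measurable AO _; exact: measurableT_comp measurable_cutoff.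
- exact: measurable_funS Omega_measurable AO ms.
- move=> x /AO Ox; rewrite gee0_abs ?cutoff_ge0// /cutoff indicE.
  by case: (_ \in _); rewrite ?mule1// mule0 s0.
Qed.

Context (V0_gt0 : 0 < V0) (q : R) (q_gt0 : 0 < q).
Context (u : Rn R n -> \bar R) (weight_u : weight Omega u).

Lemma measurable_maximal_powerM (f : Rn R n -> \bar R) :
  weight Omega (fun x => `|f x|%E) ->
  measurable_fun Omega (fun x => maximal Omega beta f x `^ q * u x)%E.
Proof.
move=> wf.
have [D [FD HD]] := countable_cubes Omega beta Omega_open Omega_proper beta01 Omega_nonempty.
apply: measurable_poweRM => //.
exact: (measurable_maximal _ _ Omega_open Omega_proper beta01 V0_gt0 _ wf _ FD HD).
Qed.

(** For x in E_i the cube Q_i competes in the supremum, and [cutoff] equals [sigma] on it, so the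
    maximal function is at least the density of Q_i. The E_i being disjoint, the sum is the integral
    of a function below the integrand. *)
Lemma testing_sum (B : R) (J : nat) (P : pred 'I_J) (E : 'I_J -> set (Rn R n))
    (Q : 'I_J -> Rn R n * R) :
  (\int[mu]_(x in cube c l) (maximal Omega beta cutoff x `^ q * u x) <= B%:E)%E ->
  admissible_family Omega beta P E Q ->
  (forall i, P i -> cube (Q i).1 (Q i).2 `<=` cube c l) ->
  \sum_(i < J | P i) wmeasR u (E i) * density sigma V0 (Q i) `^ q <= B.
Proof.
move=> HB [HE Edisj] Qc; have [mu' u0 _] := weight_u; have [ms s0 _] := weight_sigma.
rewrite -lee_fin; apply: le_trans HB.
have cO := cubes_subset _ _ beta01 _ _ Fcl.
have mc : measurable (cube c l) by exact: measurable_cube.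
pose E' i := if P i then E i else set0.
have E'c i : E' i `<=` cube c l.
  by rewrite /E'; case: ifPn => [Pi|_ x//]; have [_ _ EQ] := HE i Pi; exact: subset_trans EQ (Qc i Pi).
have E'O i : E' i `<=` Omega by exact: subset_trans (E'c i) cO.
have mE' i : measurable (E' i).
  by rewrite /E'; case: ifPn => // Pi; have [_ mE _] := HE i Pi.
pose g (k : 'I_J) x := ((density sigma V0 (Q k) `^ q)%:E * (u \_ (E' k)) x)%E.
have muE (k : 'I_J) : measurable_fun (cube c l) (u \_ (E' k)).
  apply/(measurable_restrict _ _ _) => //.
  by apply: measurable_funS mu' => // x [/cO].
have u0E (k : 'I_J) x : (0 <= (u \_ (E' k)) x)%E.
  by apply: erestrict_ge0 => y /E'O; exact: u0.
have g0 k x : (0 <= g k x)%E.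
  by rewrite mule_ge0 ?u0E// lee_fin powR_ge0.
have mg k : measurable_fun (cube c l) (g k) by exact: emeasurable_funM.
have -> : (\sum_(k < J | P k) wmeasR u (E k) * density sigma V0 (Q k) `^ q)%:E =
    (\int[mu]_(x in cube c l) \sum_(k < J) g k x)%E.
  rewrite ge0_integral_sum// -sumEFin big_mkcond/=; apply: eq_bigr => k _.
  rewrite /g ge0_integralZl_EFin ?powR_ge0//.
  rewrite -integral_mkcondr (setIidr (E'c k)) /E'; case: ifPn => [Pk|_].
    rewrite EFinM -(wmeasRE Omega beta)//; first by rewrite muleC.
      by have [] := HE k Pk.
    by have [FQ _ EQ] := HE k Pk; exists (Q k).
  by rewrite integral_set0 mule0.
have wc := weight_cutoff.
have [D [FD HD]] := countable_cubes Omega beta Omega_open Omega_proper beta01 Omega_nonempty.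
apply: ge0_le_integral.
- exact: mc.
- by move=> x _; apply: sume_ge0 => k _; exact: g0.
- exact: emeasurable_sum.
- exact: measurable_funS Omega_measurable cO (measurable_maximal_powerM _ wc).
move=> x cx; have Ox := cO _ cx.
have [[i E'i]|noE] := pselect (exists i, E' i x); last first.
  rewrite big1 ?mule_ge0 ?poweR_ge0 ?u0// => i _.
  rewrite /g /patch memNset ?mule0// => E'i; apply: noE; by exists i.
rewrite (bigD1 i)//= big1 ?adde0; last first.
  move=> j ji; rewrite /g /patch memNset ?mule0// => E'j.
  move: E'i E'j; rewrite /E'; case: ifPn => // Pi Ei; case: ifPn => // Pj Ej.
  by have := Edisj _ _ Pj Pi ji; rewrite -subset0 => /(_ x); apply.
have [Pi Ei] : P i /\ E i x by move: E'i; rewrite /E'; case: ifPn.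
have [FQ _ EQ] := HE i Pi; have FQ' : F ((Q i).1, (Q i).2) by case: (Q i) FQ.
rewrite /g /patch mem_set// lee_wpmul2r ?u0// -poweR_EFin; apply: le_poweR.
- exact: ltW.
- rewrite lee_fin; have l0 := cubes_gt0 _ _ _ _ FQ'.
  rewrite /density divr_ge0 ?mulr_ge0 ?exprn_ge0 ?(ltW l0) ?(ltW V0_gt0)//.
  by apply: (wmeasR_ge0 Omega) => //; exact: cubes_subset FQ'.
apply: ereal_sup_ubound; exists (Q i); first by split => //; exact: EQ.
rewrite (average_density _ _ Omega_open Omega_proper beta01 V0_gt0 _ wc)//.
rewrite /density /= /wmeasR /wmeas; congr ((fine _ / _)%:E).
apply: eq_integral => y; rewrite inE => Qy.
by rewrite gee0_abs ?cutoff_ge0 ?cutoff_in//; [exact: Qc Qy|exact/cO/(Qc i Pi)].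
Qed.

End testing.

(** * Equivalence of the weighted inequality and the testing condition *)

Local Open Scope ereal_scope.

Theorem theorem1p7 (R : realType) (n : nat) (Omega : set (Rn R n))
    (p q beta : R) (u v sigma : Rn R n -> \bar R) :
  open Omega -> Omega !=set0 -> Omega <> setT ->
  (1 < p)%R -> (p <= q)%R -> (0 < beta < 1)%R ->
  weight Omega u -> weight Omega v ->
  (forall x, sigma x = wpow (v x) (1 - p / (p - 1))) ->
  doubling Omega beta sigma ->
  (exists C : R, forall f : Rn R n -> \bar R, Lp_weighted Omega p v f ->
     (\int[lebesgue_measure_Rn]_(x in Omega)
        (maximal Omega beta f x `^ q * u x)) `^ (q^-1)
     <= C%:E * (\int[lebesgue_measure_Rn]_(x in Omega)
        (`|f x| `^ p * v x)) `^ (p^-1))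
  <->
  (exists C : R, forall (x0 : Rn R n) (l : R), cubes Omega beta (x0, l) ->
     (\int[lebesgue_measure_Rn]_(x in cube x0 l)
        (maximal Omega beta (fun y => sigma y * (\1_(cube x0 l) y)%:E) x `^ q
         * u x)) `^ (q^-1)
     <= C%:E * (\int[lebesgue_measure_Rn]_(x in cube x0 l)
        sigma x) `^ (p^-1) < +oo).
Proof.
move=> Omega_open Omega_nonempty Omega_neqT p_gt1 pq beta01 weight_u weight_v sigmaE
  [weight_sigma [C0 HC0]].
have p0 : (0 < p)%R by rewrite (lt_trans _ p_gt1).
have q0 : (0 < q)%R by rewrite (lt_le_trans p0).
have rr0 : (0 < q / p)%R by rewrite divr_gt0.
(* If cubes had measure zero, all integrals would vanish; handling this case
   spares the proof that Lebesgue measure is nontrivial. *)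
have [Vz|V0nz] := eqVneq (lebesgue_measure_Rn (cube (0%R : Rn R n) 1%R)) 0.
  have zero A g := @integral_lebesgue_Rn0 R n A g Vz.
  have q1 : (q^-1 != 0)%R by rewrite invr_eq0 gt_eqF.
  have p1 : (p^-1 != 0)%R by rewrite invr_eq0 gt_eqF.
  split=> _; exists 0%R.
    by move=> x0 l _; rewrite !zero !poweR0r// mule0 lexx ltry.
  by move=> f _; rewrite !zero !poweR0r// mule0.
have Omega_proper : ~` Omega !=set0.
  apply/set0P/eqP => H; apply: Omega_neqT.
  by rewrite -(setCK Omega) H setC0.
have Omega_measurable := open_proper_measurable Omega Omega_open Omega_proper.
pose V0 : R := fine (lebesgue_measure_Rn (cube (0%R : Rn R n) 1%R)).
have V0_gt0 : (0 < V0)%R.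
  rewrite /V0 fine_gt0// lebesgue_measure_cube_lty andbT lt_def V0nz.
  exact: (@measure_ge0 _ _ _ (@lebesgue_measure_Rn R n)).
have [mu' u0 _] := weight_u; have [ms s0 sloc] := weight_sigma.
have [mv v0 _] := weight_v.
split => -[C HC].
  (* The inequality is applied to sigma chi_Q, whose L^p(v) integral is at most sigma(Q) by
     [dual_weight_le]. The given constant may be negative, hence the maximum with 0. *)
  exists (Num.max 0%R C) => c l Fcl.
  have cO := cubes_subset _ _ beta01 _ _ Fcl.
  have mc : measurable (cube c l) by exact: measurable_cube.
  have Sfin : wmeas sigma (cube c l) \is a fin_num.
    by apply: (wmeas_fin Omega beta) => //; exact: in_cube_cube.
  have S0 : 0 <= wmeas sigma (cube c l) by exact: (wmeas_ge0 Omega).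
  apply/andP; split; last first.
    rewrite -/(wmeas sigma (cube c l)) -(fineK Sfin) poweR_EFin -EFinM.
    exact: ltry.
  have wc := weight_cutoff _ Omega_open Omega_proper _ weight_sigma c l.
  have mcut := measurable_cutoff Omega _ weight_sigma c l.
  have mM := measurable_maximal_powerM _ _ Omega_open Omega_proper Omega_nonempty
    beta01 V0_gt0 q u weight_u _ wc.
  have cutE : \int[lebesgue_measure_Rn]_(x in Omega) (`|cutoff sigma c l x| `^ p * v x)
      <= wmeas sigma (cube c l).
    rewrite /wmeas -(setIidr cO) integral_mkcondr; apply: ge0_le_integral.
    - exact: Omega_measurable.
    - by move=> x Ox; rewrite mule_ge0 ?poweR_ge0 ?v0.
    - exact: measurable_powR_weight.
    - apply/(measurable_restrict _ _ _) => //; exact: measurable_funS ms.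
    move=> x Ox; rewrite /patch gee0_abs ?(cutoff_ge0 Omega)//.
    case: ifPn => [|xc]; first by rewrite inE => /cutoff_in ->; rewrite sigmaE dual_weight_le ?v0.
    rewrite /cutoff indicE (negPf xc) mule0 poweR0r ?gt_eqF// mul0e//.
  have Lcut : Lp_weighted Omega p v (cutoff sigma c l).
    by split => //; apply: (le_lt_trans cutE); rewrite ltey_eq Sfin.
  apply: (@le_trans _ _ ((\int[lebesgue_measure_Rn]_(x in Omega)
      (maximal Omega beta (cutoff sigma c l) x `^ q * u x)) `^ (q^-1))).
    apply: le_poweR; first by rewrite invr_ge0 ltW.
      by apply: integral_ge0 => x /cO Ox; rewrite mule_ge0 ?poweR_ge0 ?u0.
    apply: ge0_subset_integral => //.
    by move=> x Ox; rewrite mule_ge0 ?poweR_ge0 ?u0.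
  apply: (le_trans (HC _ Lcut)).
  apply: (@le_trans _ _ ((Num.max 0%R C)%:E * (\int[lebesgue_measure_Rn]_(x in Omega)
      (`|cutoff sigma c l x| `^ p * v x)) `^ (p^-1))).
    by rewrite lee_wpmul2r ?poweR_ge0// lee_fin le_max lexx orbT.
  rewrite lee_wpmul2l ?lee_fin ?le_max ?lexx//; apply: le_poweR => //.
    by rewrite invr_ge0 ltW.
  by apply: integral_ge0 => x Ox; rewrite mule_ge0 ?poweR_ge0 ?v0.
(* The q-th power of the testing inequality turns sigma(Q)^(1/p) into sigma(Q)^(q/p) and the
   constant into [K]. *)
pose K : R := (Num.max 0 C `^ q)%R.
have K0 : (0 <= K)%R by exact: powR_ge0.
have S_gt0 c l : cubes Omega beta (c, l) -> (0 < wmeasR sigma (cube c l))%R.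
  move=> Fcl; apply: (dual_weight_gt0 _ _ Omega_open Omega_proper Omega_nonempty beta01 _
    p_gt1 _ _ weight_v weight_sigma sigmaE) => //.
  rewrite lebesgue_measure_cubeE ?lte_fin ?mulr_gt0 ?exprn_gt0//; exact: cubes_gt0 Fcl.
have doubling_sigma c l : cubes Omega beta (c, 2 * l)%R ->
    (wmeasR sigma (cube c (2 * l)) <= Num.max 1%R C0 * wmeasR sigma (cube c l))%R.
  move=> F2; have l2 := cubes_gt0 _ _ _ _ F2.
  have F1 : cubes Omega beta (c, l) by apply: cubes_shrink F2 _ _; lra.
  have := HC0 _ _ F1 F2 => /andP[H _].
  rewrite -lee_fin EFinM -!(wmeasRE Omega beta)//; try exact: measurable_cube;
    try exact: in_cube_cube.
  apply: (le_trans H); rewrite lee_wpmul2r ?lee_fin ?le_max ?lexx ?orbT//.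
  by apply: (wmeas_ge0 Omega) => //; exact: cubes_subset F1.
have testing (J : nat) (P : pred 'I_J) (E : 'I_J -> set (Rn R n))
  (Q : 'I_J -> Rn R n * R) (c : Rn R n) (l : R) : cubes Omega beta (c, l) ->
  admissible_family Omega beta P E Q ->
  (forall i, P i -> cube (Q i).1 (Q i).2 `<=` cube c l) ->
  (\sum_(i < J | P i) wmeasR u (E i) * density sigma V0 (Q i) `^ q
    <= K * wmeasR sigma (cube c l) `^ (q / p))%R.
  move=> Fcl; apply: (testing_sum _ _ Omega_open Omega_proper Omega_nonempty beta01 _
    weight_sigma _ _ Fcl V0_gt0 _ q0 _ weight_u).
  have /andP[H _] := HC c l Fcl.
  have cO := cubes_subset _ _ beta01 _ _ Fcl.
  set X := (X in X <= _).
  have X0 : 0 <= X by apply: integral_ge0 => x /cO Ox; rewrite mule_ge0 ?poweR_ge0 ?u0.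
  rewrite -[X](@poweRVK _ _ q) ?gt_eqF//.
  have XC : X `^ q^-1 <= (Num.max 0%R C * wmeasR sigma (cube c l) `^ p^-1)%:E.
    apply: (le_trans H); rewrite -/(wmeas sigma (cube c l)) (wmeasRE Omega beta)//; last 2 first.
    - exact: measurable_cube.
    - exact: in_cube_cube.
    rewrite poweR_EFin EFinM lee_wpmul2r ?lee_fin ?powR_ge0// le_max lexx orbT//.
  apply: (le_trans (le_poweR _ _ _ (ltW q0) (poweR_ge0 _ _) XC)).
  rewrite poweR_EFin lee_fin powRM ?powR_ge0 ?le_max ?lexx// -powRrM.
  by rewrite [(p^-1 * q)%R]mulrC.
have D_ge1 : (1 <= Num.max 1%R C0)%R by rewrite le_max lexx.
have [C1 C1_ge0 HC1] := finite_estimate _ _ Omega_open Omega_proper Omega_nonempty beta01 _ _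
  p_gt1 pq _ _ _ weight_u weight_v weight_sigma sigmaE _ D_ge1 doubling_sigma _ V0_gt0
  S_gt0 _ K0 testing.
exists (C1 `^ q^-1)%R => f Lp_f.
have weight_f := Lp_weighted_weight _ _ Omega_open Omega_proper Omega_nonempty beta01 _
  p_gt1 _ _ weight_v weight_sigma sigmaE _ Lp_f.
set I := \int[lebesgue_measure_Rn]_(x in Omega) (`|f x| `^ p * v x).
have I0 : 0 <= I by apply: integral_ge0 => x Ox; rewrite mule_ge0 ?poweR_ge0 ?v0.
have Ifin : I \is a fin_num by rewrite ge0_fin_numE//; case: Lp_f.
have [D [FD HD]] := countable_cubes Omega beta Omega_open Omega_proper beta01 Omega_nonempty.
have main : \int[lebesgue_measure_Rn]_(x in Omega) (maximal Omega beta f x `^ q * u x)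
    <= (C1 * fine I `^ (q / p))%:E.
  apply: (integral_maximal_le _ _ Omega_open Omega_proper beta01 V0_gt0 _ weight_f _ FD HD
    _ q0 _ weight_u) => J.
  have [E [fam HE]] := max_upto_family _ _ Omega_open Omega_proper beta01 f _ FD _ q0 _ weight_u J.
  by apply: (le_trans HE); rewrite lee_fin; exact: HC1.
apply: (le_trans (le_poweR _ _ _ _ _ main)).
- by rewrite invr_ge0 ltW.
- by apply: integral_ge0 => x Ox; rewrite mule_ge0 ?poweR_ge0 ?u0.
rewrite poweR_EFin powRM ?powR_ge0// -powRrM.
have -> : (q / p * q^-1 = p^-1)%R by rewrite mulrAC divff ?mul1r// gt_eqF.
by rewrite -[in leRHS](fineK Ifin) poweR_EFin -EFinM.
Qed.
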